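(* Let $k\ge 1$ be a fixed integer and let $p=p(n)\in[0,1]$ satisfy $p=\omega(n^{-1/k})$ and $p=o(n^{-1/(k+1)})$ as $n\to\infty$. Let $X(n,p)$ be the clique complex of the Erdős–Rényi random graph $G(n,p)$, and let $\beta_k=\beta_k(X(n,p))$. Then $$\frac{\beta_k(X(n,p))-\mathbb{E}[\beta_k(X(n,p))]}{\sqrt{\mathrm{Var}[\beta_k(X(n,p))]}}\Rightarrow\mathcal{N}(0,1)\qquad\text{as } n\to\infty .$$
   Context: $G(n,p)$ is the random graph on the vertex set $\{1,\dots,n\}$ in which each possible edge is included independently with probability $p$. The clique complex $X(H)$ of a graph $H$ is the simplicial complex on the vertex set of $H$ having a face for each set of vertices spanning a complete subgraph of $H$; $X(n,p):=X(G(n,p))$. For a finite simplicial complex $\Delta$, $\beta_k(\Delta)=\dim H_k(\Delta,\mathbb{Q})$. For non-negative $g,h$: $g(n)=o(h(n))$ means for every $\epsilon>0$, $g(n)\le\epsilon h(n)$ for all large $n$; $g(n)=\omega(h(n))$ means for every $K>0$, $g(n)\ge K h(n)$ for all large $n$. $\Rightarrow$ denotes weak convergence (convergence in distribution) and $\mathcal{N}(0,1)$ is the standard normal distribution. *)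

(* Defs.v *)
From HB Require Import structures.
From mathcomp Require Import all_boot all_order all_algebra.
From mathcomp Require Import all_classical all_reals all_analysis.
From mathcomp Require Import measurable_realfun ring.

Set Implicit Arguments.
Unset Strict Implicit.
Unset Printing Implicit Defensive.

Import Order.TTheory GRing.Theory Num.Theory.
Import numFieldNormedType.Exports.

Local Open Scope ring_scope.

(* Only nonempty faces are recorded, so that H_0 is not reduced homology. *)
Record simplicial_complex (n : nat) := SimplicialComplex {
  faces :> {set {set 'I_n}};
  faces_neq0 : finset.set0 \notin faces;
  faces_closed : forall s t : {set 'I_n},
    s \in faces -> t \subset s -> t != finset.set0 -> t \in faces }.

Section homology.
Variables (n : nat) (D : simplicial_complex n).

(* The faces with m vertices, that is, of dimension m - 1. *)
Definition faces_card (m : nat) : {set {set 'I_n}} :=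
  [set s in faces D | #|s| == m]%SET.

Definition face (m : nat) (i : 'I_#|faces_card m|) : {set 'I_n} := enum_val i.

(* The k-chains are the rational row vectors indexed by faces_card k.+1, and
   the boundary operator from k-chains to (k-1)-chains acts on them by right
   multiplication with the matrix
     [v_0 < ... < v_k] |-> \sum_i (-1)^i [v_0, ..., v_(i-1), v_(i+1), ..., v_k].
   As the empty set is not a face, boundary 0 has no columns. *)
Definition boundary (k : nat) :
    'M[rat]_(#|faces_card k.+1|, #|faces_card k|) :=
  \matrix_(i, j) \sum_(v in face i | (face i :\ v)%SET == face j)
    (-1) ^+ #|[set u in face i | (u < v)%N]%SET|.

Lemma boundaryK (k : nat) : boundary k.+1 *m boundary k = 0.
Proof.
pose sg (s : {set 'I_n}) (v : 'I_n) : rat := (-1) ^+ #|[set u in s | (u < v)%N]%SET|.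
apply/matrixP => i j; rewrite !mxE.
set s := face i; set r := face j.
have /andP[sD /eqP cs] : (s \in faces D) && (#|s| == k.+2).
  by have := enum_valP i; rewrite [in X in X -> _]inE.
pose a (s t : {set 'I_n}) : rat := \sum_(v in s | (s :\ v)%SET == t) sg s v.
transitivity (\sum_(t in faces_card k.+1) a s t * a t r).
  by rewrite [RHS]big_enum_val; apply: eq_bigr => l _; rewrite !mxE.
pose c (v w : 'I_n) := [&& v \in s, w \in s, w != v & (s :\ v :\ w)%SET == r].
pose S : rat := \sum_v \sum_(w | c v w) sg s v * sg (s :\ v)%SET w.
transitivity S.
  rewrite /S (bigID (mem s))/= [X in _ = _ + X]big1 ?addr0; last first.
    by move=> v /negbTE vs; apply: big1 => w; rewrite /c vs.
  under eq_bigr do rewrite mulr_suml.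
  rewrite (exchange_big_dep (mem s))/=; last by move=> t v _ /andP[].
  apply: eq_bigr => v vs.
  have vD : (s :\ v)%SET \in faces_card k.+1.
    have csv : #|(s :\ v)%SET| = k.+1 by move: cs; rewrite (cardsD1 v) vs => -[].
    rewrite inE csv eqxx andbT (faces_closed sD) ?subsetDl//.
    by rewrite -card_gt0 csv.
  rewrite (big_pred1 (s :\ v)%SET); last first.
    move=> t; rewrite /= vs/= [RHS]eq_sym andb_idl// => /eqP <-//.
  rewrite mulr_sumr; apply: eq_bigl => w.
  by rewrite /c vs !inE/= -andbA andbCA.
have cC v w : c v w = c w v.
  by rewrite /c [v == w]eq_sym !finset.setDDl finset.setUC andbCA.
have SN : S = - S.
  rewrite {1}/S (exchange_big_dep xpredT)//= /S -sumrN; apply: eq_bigr => v _.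
  rewrite -sumrN (eq_bigl _ _ (cC^~ v)); apply: eq_bigr => w /and4P[vs ws wv _].
  have sgD x y : x \in s -> x != y ->
      sg (s :\ x)%SET y = (-1) ^+ (x < y)%N * sg s y.
    move=> xs xy; rewrite /sg.
    case: ltnP => xy'.
      rewrite (cardsD1 x [set u in s | (u < y)%N]%SET) inE xs xy'.
      rewrite exprD mulrA expr1 mulrNN !mul1r; congr (_ ^+ _).
      by apply: eq_card => u; rewrite !inE andbA.
    rewrite expr0 mul1r; congr (_ ^+ _); apply: eq_card => u; rewrite !inE.
    by case: eqVneq => [->|_] /=; rewrite ?[(x < y)%N]ltnNge ?xy' ?andbF.
  rewrite (sgD w v ws wv) (sgD v w vs) 1?eq_sym//.
  have [wv'|vw|/val_inj wv'] := ltngtP w v.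
  - by rewrite expr1 expr0; ring.
  - by rewrite expr1 expr0; ring.
  - by rewrite wv' eqxx in wv.
by apply/eqP; rewrite -[_ == 0](mulrn_eq0 S 2) mulr2n {1}SN addNr.
Qed.

Lemma boundary_sub_cycle (k : nat) :
  (boundary k.+1 <= kermx (boundary k))%MS.
Proof. by apply/sub_kermxP; exact: boundaryK. Qed.

(* The dimension of H_k = ker (boundary k) / im (boundary k.+1); the
   subtraction is not truncated, by boundary_sub_cycle. *)
Definition betti (k : nat) : nat :=
  (\rank (kermx (boundary k)) - \rank (boundary k.+1))%N.

End homology.

Section graphs.
Variable n : nat.

Definition edge : predArgType := {e : {set 'I_n} | #|e| == 2%N}.

(* The simple graphs on the vertex set 'I_n, given by their edge sets. *)
Definition graph : Type := {set edge}.

HB.instance Definition _ := Finite.on graph.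
HB.instance Definition _ := isPointed.Build graph finset.set0.
HB.instance Definition _ := @isMeasurable.Build default_measure_display
  graph discrete_measurable discrete_measurable0
  discrete_measurableC discrete_measurableU.

Definition adjacent (G : graph) (i j : 'I_n) : bool :=
  [exists e : edge, (e \in (G : {set edge})) && (val e == [set i; j]%SET)].

Definition clique (G : graph) (s : {set 'I_n}) : bool :=
  [forall i in s, forall j in s, (i != j) ==> adjacent G i j].

Definition cliques (G : graph) : {set {set 'I_n}} :=
  [set s | (s != finset.set0) && clique G s]%SET.

Lemma cliques_neq0 (G : graph) : finset.set0 \notin cliques G.
Proof. by rewrite inE eqxx. Qed.

Lemma cliques_closed (G : graph) (s t : {set 'I_n}) :
  s \in cliques G -> t \subset s -> t != finset.set0 -> t \in cliques G.
Proof.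
rewrite !inE => /andP[_ /forall_inP cs] /fintype.subsetP ts -> /=.
apply/forall_inP => i /ts/cs /forall_inP ci.
by apply/forall_inP => j /ts/ci.
Qed.

Definition clique_complex (G : graph) : simplicial_complex n :=
  SimplicialComplex (cliques_neq0 G) (@cliques_closed G).

End graphs.

Section random_graph.
Context {R : realType} (n : nat).
Local Open Scope ereal_scope.

Definition gnp_pmf (p : R) (G : graph n) : R :=
  (\prod_(e : edge n) bernoulli_pmf p (e \in (G : {set edge n})))%R.

(* The law of G(n,p); as for bernoulli_prob, the value outside of
   0 <= p <= 1 is a dummy. *)
Definition gnp (p : R) : set (graph n) -> \bar R :=
  fun A => if (0 <= p <= 1)%R then
    \sum_(G : graph n) (gnp_pmf p G)%:E * \d_G A
  else \d_(finset.set0 : graph n) A.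

Lemma gnp_pmf_ge0 (p : R) (G : graph n) :
  (0 <= p <= 1)%R -> (0 <= gnp_pmf p G)%R.
Proof. by move=> p01; apply: prodr_ge0 => e _; exact: bernoulli_pmf_ge0. Qed.

Lemma sum_gnp_pmf (p : R) : (\sum_(G : graph n) gnp_pmf p G = 1)%R.
Proof.
transitivity (\prod_(e : edge n) (p + (1 - p)))%R; last first.
  by rewrite big1// => e _; rewrite subrKC.
by rewrite bigA_distr; apply: eq_bigr => G _; apply: eq_bigr => e _.
Qed.

Variable p : R.

Let gnp0 : gnp p set0 = 0.
Proof.
rewrite /gnp; case: ifPn => _; rewrite ?measure0//.
by rewrite big1// => G _; rewrite measure0 mule0.
Qed.

Let gnp_ge0 A : 0 <= gnp p A.
Proof.
rewrite /gnp; case: ifPn => p01; rewrite ?measure_ge0//.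
by apply: sume_ge0 => G _; rewrite mule_ge0// lee_fin gnp_pmf_ge0.
Qed.

Let gnp_sigma_additive : semi_sigma_additive (gnp p).
Proof.
move=> F mF tF mUF; rewrite /gnp; case: ifPn => p01; last first.
  exact: measure_semi_sigma_additive.
under eq_fun do rewrite exchange_big/=.
apply: cvg_nnesum => G _.
  apply: nearW => m; apply: sume_ge0 => i _.
  by rewrite mule_ge0// lee_fin gnp_pmf_ge0.
pose c : {nonneg R} := NngNum (gnp_pmf_ge0 G p01).
exact: (@measure_semi_sigma_additive _ _ _
  (mscale c (\d_G : {measure set (graph n) -> \bar R}))).
Qed.

HB.instance Definition _ := isMeasure.Build _ _ _ (gnp p)
  gnp0 gnp_ge0 gnp_sigma_additive.

Let gnp_setT : gnp p [set: graph n] = 1.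
Proof.
rewrite /gnp; case: ifPn => p01; rewrite ?probability_setT//.
under eq_bigr do rewrite probability_setT mule1.
by rewrite sumEFin sum_gnp_pmf.
Qed.

HB.instance Definition _ :=
  @Measure_isProbability.Build _ _ R (gnp p) gnp_setT.

End random_graph.
Arguments gnp {R} n p A.

Section betti_rv.
Context {R : realType} (k n : nat).

Definition betti_rv (G : graph n) : R := (betti (clique_complex G) k)%:R.

Let measurable_betti_rv : measurable_fun [set: graph n] betti_rv.
Proof. by []. Qed.

HB.instance Definition _ := isMeasurableFun.Build _ _ _ _
  betti_rv measurable_betti_rv.

End betti_rv.
Arguments betti_rv {R} k n G.

Section standardized.
Context {d} {T : measurableType d} {R : realType} (P : probability T R).
Variable X : {RV P >-> R}.

(* Identically 0 when X has variance 0, since division by 0 yields 0. *)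
Definition standardized : T -> R :=
  fun w => (X w - fine 'E_P[X]) / Num.sqrt (fine 'V_P[X]).

Let measurable_standardized : measurable_fun [set: T] standardized.
Proof. by apply: measurable_funM => //; exact: measurable_funB. Qed.

HB.instance Definition _ := isMeasurableFun.Build _ _ _ _
  standardized measurable_standardized.

End standardized.
Arguments standardized {d T R} P X w.

Local Open Scope classical_set_scope.

(* R and measurableTypeR R carry the same Borel sigma-algebra under different
   displays; distribution uses the former and normal_prob the latter. *)
Definition weak_cvg {R : realType} (mu_ : nat -> probability R R)
    (mu : probability (measurableTypeR R) R) : Prop :=
  forall f : R -> R, continuous f -> bounded_fun f ->
    (\int[mu_ n]_x (f x)%:E)%E @[n --> \oo] --> (\int[mu]_x (f x)%:E)%E.

Definition little_omega {R : realType} (g h : nat -> R) : Prop :=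
  forall K : R, 0 < K -> \forall n \near \oo, K * h n <= g n.

(* Main.v *)
Require Import Defs.
From mathcomp Require Import all_boot all_order all_algebra.
From mathcomp Require Import all_classical all_reals all_analysis.
From mathcomp Require Import measurable_realfun ring lra zify.
Import Order.TTheory GRing.Theory Num.Theory.
Import numFieldNormedType.Exports.
Local Open Scope classical_set_scope.
Local Open Scope ring_scope.

Set Implicit Arguments.
Unset Strict Implicit.
Unset Printing Implicit Defensive.

(** In this regime the fluctuations of the Betti number are those of the number
of edges. Write [beta] for the Betti number in degree [k], [f] for the number
of cliques with [k + 1] vertices, and [r], [r'] for the ranks of the boundary
maps out of and into degree [k], so that [beta = f - r - r']. Let [c] be the
mean number of cliques with [k + 1] vertices that the addition of one given
edge completes, and put [g = beta - c * #edges].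

The Efron-Stein inequality bounds the variance of [g] by the mean squares of the
effects of single edges on [g]. The effect of an edge has three parts.
- On [f] minus [c * #edges] it is the number [M] of cliques completed by the
  edge, minus its mean. Two cliques sharing [j] vertices besides the edge are
  rarer than two sharing only the edge by a factor [(n p^k)^j] at least, so the
  variance of [M] is [O(c^2 / (n p^k))] ([variance_cliques_through]).
- On [r'] it is at most the number of completed cliques with [k + 2] vertices,
  whose mean square is [O(c^2 (x^2 + x))] for [x = n p^(k+1)]
  ([mean_sqr_cliques_through_succ]).
- On [r] it is at most [M], which is too weak by itself when [n p^k] grows
  slowly. However, the sum over all edges of the drops of [r] caused by deleting
  an edge is at most a constant times [r], because deleting an edge removes only
  the members through that edge from a fixed basis of the row space
  ([sum_span_rank_drop]); and [r] is at most the number of cliques with [k]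
  vertices, which is smaller than [f] by a factor of order [n p^k].
Together, [g] has variance [o(c^2 Var #edges)] ([variance_betti_sub_edges]), and
hence the standardized Betti number is close in mean square to the standardized
number of edges ([standardized_close]).

The number of edges is binomial, with variance tending to infinity. For it the
central limit theorem is proved by exchanging the edges one by one for Gaussian
increments ([binomial_clt_gkernel]). The test functions there are the Gaussian
densities themselves: the effect of a Gaussian increment on such a density is
just to increase its variance. Smoothing by a narrow Gaussian then reaches
all continuous functions with compact support ([gaussian_test_approx]), and a
cutoff reaches the bounded ones ([bounded_test_functions]). *)

(** * The Efron-Stein inequality for random subsets *)

Section random_subset.
Context {R : realType} (T : finType) (p : R).
Implicit Types (f g : {set T} -> R) (G : {set T}) (e : T).

Definition weight (G : {set T}) : R := \prod_e bernoulli_pmf p (e \in G).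

Definition mean (f : {set T} -> R) : R := \sum_G weight G * f G.

Definition resample (e : T) (f : {set T} -> R) : {set T} -> R :=
  fun G => p * f (e |: G)%SET + (1 - p) * f (G :\ e)%SET.

Definition influence (e : T) (f : {set T} -> R) : {set T} -> R :=
  fun G => f (e |: G)%SET - f (G :\ e)%SET.

Lemma eq_mean f g : f =1 g -> mean f = mean g.
Proof. by move=> fg; apply: eq_bigr => G _; rewrite fg. Qed.

Lemma meanD f g : mean (fun G => f G + g G) = mean f + mean g.
Proof. by rewrite -big_split; apply: eq_bigr => G _; rewrite mulrDr. Qed.

Lemma meanZ c f : mean (fun G => c * f G) = c * mean f.
Proof. by rewrite mulr_sumr; apply: eq_bigr => G _; rewrite mulrCA. Qed.

Lemma meanB f g : mean (fun G => f G - g G) = mean f - mean g.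
Proof.
rewrite meanD; congr (_ + _); rewrite -mulN1r -meanZ.
by apply: eq_mean => G; rewrite mulN1r.
Qed.

Lemma mean_sum (I : Type) (r : seq I) (P : pred I) (F : I -> {set T} -> R) :
  mean (fun G => \sum_(i <- r | P i) F i G) = \sum_(i <- r | P i) mean (F i).
Proof. by rewrite exchange_big; apply: eq_bigr => G _; rewrite mulr_sumr. Qed.

Lemma sum_weight : \sum_G weight G = 1.
Proof.
transitivity (\prod_(e : T) (p + (1 - p))); last first.
  by rewrite big1// => e _; rewrite subrKC.
by rewrite bigA_distr; apply: eq_bigr => G _; apply: eq_bigr.
Qed.

Lemma mean_cst c : mean (fun=> c) = c.
Proof. by rewrite /mean -mulr_suml sum_weight mul1r. Qed.

(** As the weight is a product over the points, [resample e f] is the conditional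
expectation of [f] given all points other than [e]. *)
Lemma mean_resample e f : mean (resample e f) = mean f.
Proof.
pose W G := \prod_(i | i != e) bernoulli_pmf p (i \in G).
have split h : mean h = \sum_(G : {set T} | e \notin G) W G * resample e h G.
  rewrite /mean (bigID (fun G : {set T} => e \notin G))/=.
  rewrite [X in _ + X](reindex_onto (fun G => e |: G)%SET (fun G => G :\ e)%SET)/=;
    last by move=> G; rewrite negbK => /finset.setD1K.
  rewrite [X in _ + X](eq_bigl (fun G : {set T} => e \notin G)); last first.
    move=> G; rewrite in_setU1 eqxx/=; apply/eqP/idP => [<-|/finset.setU1K//].
    by rewrite in_setD1 eqxx.
  rewrite -big_split/=; apply: eq_bigr => G eG.
  have w1 : weight (e |: G)%SET = p * W G.
    rewrite /weight (bigD1 e)//= in_setU1 eqxx/=; congr (_ * _).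
    by apply: eq_bigr => i /negPf ie; rewrite in_setU1 ie.
  have w0 : weight G = (1 - p) * W G.
    by rewrite /weight (bigD1 e)//= (negPf eG).
  rewrite w1 w0 /resample (_ : G :\ e = G)%SET; first by ring.
  by apply/finset.setP => i; rewrite in_setD1; case: eqVneq => // ->; rewrite (negPf eG).
rewrite !split; apply: eq_bigr => G _; congr (_ * _).
rewrite {1}/resample; set r1 := resample e f _; set r0 := resample e f _.
have -> : r1 = resample e f G.
  by rewrite /r1 /resample finset.setUA finset.setUid finset.setDUl finset.setDv finset.set0U.
have -> : r0 = resample e f G.
  rewrite /r0 /resample finset.setDDl finset.setUid; congr (_ * f _ + _).
  by apply/finset.setP => i; rewrite !inE; case: eqVneq.
by ring.
Qed.

Hypothesis p01 : 0 <= p <= 1.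

Lemma weight_ge0 G : 0 <= weight G.
Proof. by apply: prodr_ge0 => e _; exact: bernoulli_pmf_ge0. Qed.

Lemma le_mean f g : (forall G, f G <= g G) -> mean f <= mean g.
Proof. by move=> fg; apply: ler_sum => G _; rewrite ler_wpM2l ?weight_ge0. Qed.

Lemma mean_ge0 f : (forall G, 0 <= f G) -> 0 <= mean f.
Proof. by move=> f0; apply: sumr_ge0 => G _; rewrite mulr_ge0 ?weight_ge0. Qed.

Lemma ler_norm_mean f : `|mean f| <= mean (fun G => `|f G|).
Proof.
apply: le_trans (ler_norm_sum _ _ _) _; apply: ler_sum => G _.
by rewrite normrM ger0_norm ?weight_ge0.
Qed.

Definition variance f : R := mean (fun G => (f G - mean f) ^+ 2).

Lemma varianceE f : variance f = mean (fun G => f G ^+ 2) - mean f ^+ 2.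
Proof.
rewrite /variance (_ : mean _ = mean (fun G => f G ^+ 2) +
    mean (fun G => - (mean f *+ 2) * f G) + mean (fun=> mean f ^+ 2)).
  by rewrite meanZ mean_cst; ring.
by rewrite -!meanD; apply: eq_mean => G; ring.
Qed.

Lemma variance_ge0 f : 0 <= variance f.
Proof. by apply: mean_ge0 => G; exact: sqr_ge0. Qed.

Lemma resample_sqr e f G :
  resample e (fun G => f G ^+ 2) G =
  resample e f G ^+ 2 + p * (1 - p) * influence e f G ^+ 2.
Proof. by rewrite /resample /influence; ring. Qed.

Lemma influence_resample_eq e f G : influence e (resample e f) G = 0.
Proof.
rewrite /influence /resample finset.setUA finset.setUid finset.setDUl finset.setDv finset.set0U.
rewrite finset.setDDl finset.setUid (_ : e |: G :\ e = e |: G)%SET ?subrr//.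
by apply/finset.setP => i; rewrite !inE; case: eqVneq.
Qed.

Lemma influence_resample_neq e e' f G : e != e' ->
  influence e (resample e' f) G = resample e' (influence e f) G.
Proof.
move=> ee'; rewrite /influence /resample.
have -> : ((e |: G) :\ e' = e |: (G :\ e'))%SET.
  by apply/finset.setP => i; rewrite !inE; case: (eqVneq i e) => // ->; rewrite ee'.
have -> : (e' |: (G :\ e) = (e' |: G) :\ e)%SET.
  by apply/finset.setP => i; rewrite !inE; case: (eqVneq i e') => // ->; rewrite eq_sym ee'.
rewrite (finset.setUCA [set e']%SET) (_ : (G :\ e :\ e' = G :\ e' :\ e)%SET); first by ring.
by rewrite !finset.setDDl finset.setUC.
Qed.

Lemma mean_influence_resample e e' f :
  mean (fun G => influence e (resample e' f) G ^+ 2) <=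
  mean (fun G => influence e f G ^+ 2).
Proof.
case: (eqVneq e e') => [->|ee'].
  apply: le_mean => G; rewrite influence_resample_eq expr0n/=; exact: sqr_ge0.
rewrite -[leRHS](mean_resample e'); apply: le_mean => G.
rewrite influence_resample_neq// resample_sqr lerDl mulr_ge0 ?sqr_ge0//.
by case/andP: p01 => p0 p1; rewrite mulr_ge0// subr_ge0.
Qed.

(** Resampling the points of [r] one at a time, the second moment decreases at
each step by the squared influence of the point, which earlier averaging can
only have diminished. *)
Lemma mean_sqr_resample (r : seq T) f :
  mean (fun G => f G ^+ 2) <=
  mean (fun G => (foldl (fun h e => resample e h) f r) G ^+ 2) +
  p * (1 - p) * \sum_(e <- r) mean (fun G => influence e f G ^+ 2).
Proof.
elim: r f => [|e r IH] f /=; first by rewrite big_nil mulr0 addr0.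
rewrite big_cons -(mean_resample e) mulrDr.
under eq_mean do rewrite resample_sqr.
rewrite meanD meanZ [_ * mean _ + _]addrC addrA lerD2r.
apply: le_trans (IH _) _; rewrite lerD2l ler_wpM2l//.
  by case/andP: p01 => p0 p1; rewrite mulr_ge0// subr_ge0.
by apply: ler_sum => e' _; exact: mean_influence_resample.
Qed.

Lemma foldl_resample_ext (r : seq T) f :
  (forall G H : {set T}, (forall e, e \notin r -> (e \in G) = (e \in H)) ->
    foldl (fun h e => resample e h) f r G = foldl (fun h e => resample e h) f r H).
Proof.
elim/last_ind: r => [|r e IH] G H GH /=.
  by congr f; apply/finset.setP => e; rewrite GH.
rewrite foldl_rcons /resample; congr (_ * _ + _ * _); apply: IH => i ir;
  rewrite !inE; case: (eqVneq i e) => //= ie;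
  by apply: GH; rewrite mem_rcons inE negb_or ie.
Qed.

Lemma mean_foldl_resample (r : seq T) f :
  mean (foldl (fun h e => resample e h) f r) = mean f.
Proof. by elim: r f => //= e r IH f; rewrite IH mean_resample. Qed.

(** Once every point has been resampled, only the constant [mean f] is left. *)
Lemma efron_stein f :
  variance f <= p * (1 - p) * \sum_e mean (fun G => influence e f G ^+ 2).
Proof.
rewrite varianceE lerBlDl; apply: le_trans (mean_sqr_resample (index_enum T) f) _.
rewrite lerD2r; set h := foldl _ _ _.
have hc G : h G = h finset.set0.
  by apply: foldl_resample_ext => e; rewrite mem_index_enum.
rewrite -(mean_foldl_resample (index_enum T) f) -/h.
by rewrite (eq_mean hc) (eq_mean (g := fun=> h finset.set0 ^+ 2)) ?mean_cst// => G; rewrite hc.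
Qed.

(** Each resampling of a point of [A] extracts one factor [p]. *)
Lemma mean_subset (A : {set T}) : mean (fun G => (A \subset G)%:R) = p ^+ #|A|.
Proof.
move: {2}#|A| (erefl #|A|) => m; elim: m A => [|m IH] A.
  move=> /cards0_eq ->; rewrite cards0 expr0 -[RHS](mean_cst 1).
  by apply: eq_mean => G; rewrite finset.sub0set.
move=> cA; have [e eA] : exists e, e \in A by apply/set0Pn; rewrite -card_gt0 cA.
have cA' : #|(A :\ e)%SET| = m by move: cA; rewrite (cardsD1 e) eA => -[].
have := IH _ cA'; rewrite cA' cA exprS => <-; rewrite -(mean_resample e) -meanZ; apply: eq_mean => G.
rewrite /resample (_ : A \subset G :\ e = false)%SET ?mulr0 ?addr0; last first.
  by apply/negP => /fintype.subsetP/(_ _ eA); rewrite !inE eqxx.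
by rewrite finset.subDset.
Qed.

(** The influence of [e] does not depend on whether [e] is present, and [e] is
present with probability [p]. *)
Lemma mean_influence e f :
  p * mean (influence e f) = mean (fun G => (e \in G)%:R * (f G - f (G :\ e)%SET)).
Proof.
rewrite -[RHS](mean_resample e) -meanZ; apply: eq_mean => G.
rewrite /resample !inE eqxx !mul0r mulr0 addr0 mul1r; congr (p * (_ - f _)).
by apply/finset.setP => i; rewrite !inE; case: eqVneq.
Qed.

Section count.
Variables (I : finType) (A : I -> {set T}) (J : {set I}).

Let countE G : #|[set i in J | A i \subset G]%SET|%:R = \sum_(i in J) (A i \subset G)%:R :> R.
Proof.
rewrite -sum1_card natr_sum [LHS]big_mkcond [RHS]big_mkcond; apply: eq_bigr => i _.
by rewrite inE; case: (i \in J); case: (A i \subset G).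
Qed.

Lemma mean_count :
  mean (fun G => #|[set i in J | A i \subset G]%SET|%:R) = \sum_(i in J) p ^+ #|A i|.
Proof.
by under eq_mean do rewrite countE; rewrite mean_sum; under eq_bigr do rewrite mean_subset.
Qed.

Lemma mean_count_sqr :
  mean (fun G => #|[set i in J | A i \subset G]%SET|%:R ^+ 2) =
  \sum_(i in J) \sum_(j in J) p ^+ #|A i :|: A j|%SET.
Proof.
under eq_mean do rewrite countE expr2 mulr_suml.
rewrite mean_sum; apply: eq_bigr => i _; under eq_mean do rewrite mulr_sumr.
rewrite mean_sum; apply: eq_bigr => j _; rewrite -mean_subset; apply: eq_mean => G.
by rewrite finset.subUset; case: (A i \subset G); case: (A j \subset G); rewrite ?mulr1 ?mul0r ?mulr0 ?mul1r.
Qed.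

End count.

Let card_count G : #|G| = #|[set i in [set: T] | [set i] \subset G]%SET|%SET.
Proof. by apply: eq_card => i; rewrite !inE finset.sub1set. Qed.

Lemma mean_card : mean (fun G => #|G|%:R) = #|T|%:R * p.
Proof.
under eq_mean do rewrite card_count.
rewrite mean_count (eq_bigr (fun=> p)); last by move=> i _; rewrite cards1.
by rewrite sumr_const cardsT mulr_natl.
Qed.

Lemma variance_card : variance (fun G => #|G|%:R) = #|T|%:R * p * (1 - p).
Proof.
rewrite varianceE mean_card; under eq_mean do rewrite card_count.
rewrite mean_count_sqr (eq_bigr (fun=> #|T|%:R * p ^+ 2 + p * (1 - p))).
  by rewrite sumr_const cardsT -[X in X - _]mulr_natl; ring.
move=> i _; rewrite (bigD1 i) ?finset.in_setT//= finset.setUid cards1 expr1.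
rewrite (eq_bigr (fun=> p ^+ 2)); last first.
  by move=> j /andP[_ ji]; rewrite cards2 eq_sym ji.
rewrite sumr_const (_ : #|_| = #|T|.-1); last first.
  rewrite -[in RHS]cardsT (cardsD1 i [set: T]%SET) finset.in_setT add1n /=.
  by apply: eq_card => j; rewrite !inE unfold_in /= inE andbT.
have T0 : (0 < #|T|)%N by apply/card_gt0P; exists i.
by rewrite -[X in _ = X%:R * _ + _](prednK T0) -[_ *+ _]mulr_natl -natr1; ring.
Qed.

End random_subset.

(** * Ranks of subfamilies and boundary matrices *)

Section span_rank.
Context {F : fieldType} {m : nat} (I : finType) (v : I -> 'rV[F]_m).
Implicit Types A B C : {set I}.

Definition span_rank A : nat := \rank (\sum_(i in A) <<v i>>)%MS.

Lemma span_rankS A B : A \subset B -> (span_rank A <= span_rank B)%N.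
Proof.
move=> /fintype.subsetP AB; apply: mxrankS; apply/sumsmx_subP => i iA.
by apply: (sumsmx_sup i) => //; exact: AB.
Qed.

Lemma span_rankU A B : (span_rank (A :|: B)%SET <= span_rank A + #|B|)%N.
Proof.
apply: (@leq_trans (\rank (\sum_(i in A) <<v i>> + \sum_(i in B) <<v i>>)%MS)).
  apply: mxrankS; apply/sumsmx_subP => i; rewrite inE => /orP[iA|iB].
    by apply: submx_trans (addsmxSl _ _); exact: (sumsmx_sup i).
  by apply: submx_trans (addsmxSr _ _); exact: (sumsmx_sup i).
apply: leq_trans (mxrank_adds_leqif _ _) _; rewrite leq_add2l.
apply: leq_trans (mxrank_sum_leqif _) _ => /=; rewrite -sum1_card.
by apply: leq_sum => i _; rewrite mxrank_gen rank_leq_row.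
Qed.

Lemma span_rankD A B : (span_rank A <= span_rank (A :\: B)%SET + #|A :&: B|%SET)%N.
Proof. by rewrite -{1}(finset.setID A B) finset.setUC; exact: span_rankU. Qed.

(** A greedily chosen independent subfamily keeps the span. *)
Lemma span_rank_basis A : exists2 B : {set I},
  B \subset A & (#|B| <= span_rank A)%N /\ (span_rank A <= span_rank B)%N.
Proof.
suff [B [BA cB sB]] : exists B : {set I}, [/\ B \subset A, (#|B| <= span_rank B)%N &
    (\sum_(i in A) <<v i>> <= \sum_(i in B) <<v i>>)%MS].
  by exists B => //; split; [exact: leq_trans cB (span_rankS BA) | exact: mxrankS].
move: {2}#|A| (erefl #|A|) => c; elim: c A => [|c IH] A.
  move=> /cards0_eq ->; exists finset.set0; split=> //; by rewrite cards0.
move=> cA; have [i iA] : exists i, i \in A by apply/set0Pn; rewrite -card_gt0 cA.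
have [|B [BA cB sB]] := IH (A :\ i)%SET; first by move: cA; rewrite (cardsD1 i) iA => -[].
have iB : i \notin B.
  by apply/negP => /(fintype.subsetP BA); rewrite !inE eqxx.
have BA' : B \subset A by apply: fintype.subset_trans BA _; exact: subD1set.
have sA j : j \in A -> j != i -> (<<v j>> <= \sum_(i in B) <<v i>>)%MS.
  move=> jA ji; apply: submx_trans sB; apply: (sumsmx_sup j) => //.
  by rewrite !inE ji.
have [vB|vB] := boolP (<<v i>> <= \sum_(i in B) <<v i>>)%MS.
  exists B; split => //; apply/sumsmx_subP => j jA.
  by case: (eqVneq j i) => [->//|]; exact: sA.
have sub : (\sum_(i in B) <<v i>> <= \sum_(j in (i |: B)%SET) <<v j>>)%MS.
  by apply/sumsmx_subP => j jB; apply: (sumsmx_sup j); rewrite // !inE jB orbT.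
exists (i |: B)%SET; split.
- by rewrite finset.subUset finset.sub1set iA.
- rewrite cardsU1 iB add1n; apply: leq_ltn_trans cB _; rewrite ltnNge.
  apply: contra vB => le; 
  apply: submx_trans (_ : (<<v i>> <= \sum_(j in (i |: B)%SET) <<v j>>)%MS) _.
    by apply: (sumsmx_sup i); rewrite // !inE eqxx.
  by rewrite -(geq_leqif (mxrank_leqif_sup sub)).
- apply/sumsmx_subP => j jA; case: (eqVneq j i) => [->|ji].
    by apply: (sumsmx_sup i); rewrite // !inE eqxx.
  exact: submx_trans (sA _ jA ji) sub.
Qed.

(** Deleting rows from a family lowers its rank by at most the number of deleted
members of a fixed basis; this is what keeps the total over many deletions
proportional to the rank. *)
Lemma sum_span_rank_drop (J : finType) (P : pred J) (C : J -> {set I}) A (b : nat) :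
  (forall i, i \in A -> #|[set j | P j & i \in C j]%SET| <= b)%N ->
  (\sum_(j | P j) (span_rank A - span_rank (A :\: C j)%SET) <= b * span_rank A)%N.
Proof.
move=> Cb; have [B BA [cB sB]] := span_rank_basis A.
apply: (@leq_trans (\sum_(j | P j) #|B :&: C j|%SET)).
  apply: leq_sum => j _; rewrite leq_subLR; apply: leq_trans sB _.
  apply: leq_trans (span_rankD B (C j)) _; rewrite leq_add2r.
  by apply: span_rankS; exact: finset.setSD.
apply: (@leq_trans (\sum_(i in B) #|[set j | P j & i \in C j]%SET|)).
  rewrite (eq_bigr (fun j => \sum_(i in B) (i \in C j))%N); last first.
    move=> j _; rewrite -sum1_card [RHS]big_mkcond [LHS]big_mkcond/=.
    by apply: eq_bigr => i _; rewrite inE; case: (i \in B); case: (i \in C j).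
  rewrite exchange_big/=; apply: leq_sum => i _; rewrite -sum1_card.
  rewrite [X in (X <= _)%N]big_mkcond [X in (_ <= X)%N]big_mkcond/=.
  by apply: leq_sum => j _; rewrite inE; case: (P j); case: (i \in C j).
apply: leq_trans (_ : \sum_(i in B) b <= _)%N.
  by apply: leq_sum => i iB; apply: Cb; exact: (fintype.subsetP BA).
by rewrite sum_nat_const mulnC leq_mul2l cB orbT.
Qed.

End span_rank.

Section boundary_rank.
Variable n : nat.

(** The row of [s] in the boundary matrix of the full simplex on all vertices,
with a column for every set of vertices. *)
Definition boundary_row (s : {set 'I_n}) : 'rV[rat]_#|{: {set 'I_n}}| :=
  \row_j \sum_(v in s | (s :\ v)%SET == enum_val j)
    (-1) ^+ #|[set u in s | (u < v)%N]%SET|.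

(** The rows of the faces of [D] vanish outside the columns of the faces of [D],
because [D] is closed under taking faces. In degree [0] this fails: the empty
set is not a face. *)
Lemma rank_boundary (D : simplicial_complex n) (k : nat) : (0 < k)%N ->
  \rank (boundary D k) = span_rank boundary_row (faces_card D k.+1).
Proof.
move=> k0; pose P : 'M[rat]_(#|faces_card D k|, #|{: {set 'I_n}}|) :=
  \matrix_(i, j) (face i == enum_val j)%:R.
have Pfree : row_free P.
  apply/row_freeP; exists P^T; apply/matrixP => i j; rewrite !mxE.
  rewrite (bigD1 (enum_rank (face i)))//= !mxE enum_rankK eqxx mul1r.
  rewrite big1 ?addr0; last first.
    move=> l li; rewrite !mxE (_ : face i == enum_val l = false) ?mul0r//.
    by apply: contraNF li => /eqP ->; rewrite enum_valK.
  rewrite (_ : face j == face i = (i == j))//.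
  by apply/eqP/eqP => [/enum_val_inj->|->].
rewrite -(mxrankMfree (boundary D k) Pfree).
have rowE i : row i (boundary D k *m P) = boundary_row (face i).
  apply/rowP => j; rewrite !mxE; set t := enum_val j.
  pose a (s t : {set 'I_n}) : rat := \sum_(v in s | (s :\ v)%SET == t)
    (-1) ^+ #|[set u in s | (u < v)%N]%SET|.
  transitivity (\sum_(t' in faces_card D k) a (face i) t' * (t' == t)%:R).
    by rewrite [RHS]big_enum_val; apply: eq_bigr => l _; rewrite !mxE.
  have [tD|tD] := boolP (t \in faces_card D k).
    rewrite (bigD1 t)//= eqxx mulr1 big1 ?addr0// => t' /andP[_ /negPf ->].
    by rewrite mulr0.
  rewrite big1; last first.
    move=> t' t'D; case: eqVneq => [E|]; last by rewrite mulr0.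
    by rewrite E (negPf tD) in t'D.
  rewrite big_pred0// => v; apply/negbTE; apply: contra tD => /andP[vi /eqP <-].
  have := enum_valP i; rewrite !inE => /andP[sD cs].
  have cs' : #|(face i :\ v)%SET| == k.
    by move: cs; rewrite (cardsD1 v (enum_val i)) vi.
  rewrite cs' andbT (faces_closed sD) ?subD1set//.
  by rewrite -card_gt0 (eqP cs').
apply/eqP; rewrite eqn_leq; apply/andP; split; apply: mxrankS.
  apply/row_subP => i; rewrite rowE; apply: (sumsmx_sup (face i)); first exact: enum_valP.
  by rewrite genmxE.
apply/sumsmx_subP => s sD; rewrite genmxE.
have -> : s = face (enum_rank_in sD s) by rewrite /face enum_rankK_in.
by rewrite -rowE row_sub.
Qed.

(** Stated as a sum because the subtractions are truncated. *)
Lemma betti_rank (D : simplicial_complex n) (k : nat) : (0 < k)%N ->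
  (betti D k + span_rank boundary_row (faces_card D k.+1) +
   span_rank boundary_row (faces_card D k.+2))%N = #|faces_card D k.+1|.
Proof.
move=> k0; rewrite /betti -!rank_boundary// mxrank_ker.
have := mxrankS (boundary_sub_cycle D k); rewrite mxrank_ker => le.
have le' := rank_leq_row (boundary D k).
by rewrite addnAC subnK// subnK.
Qed.

Lemma span_rank_boundary_le (D : simplicial_complex n) (k : nat) : (0 < k)%N ->
  (span_rank boundary_row (faces_card D k.+1) <= #|faces_card D k|)%N.
Proof. by move=> k0; rewrite -rank_boundary// rank_leq_col. Qed.

End boundary_rank.

(** * Cliques and edges *)

Section clique_counts.
Variable n : nat.
Implicit Types (G : {set edge n}) (S : {set 'I_n}) (e : edge n) (a : nat).

Definition edges_in S : {set edge n} := [set e : edge n | val e \subset S]%SET.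

Definition cliques_of_size a G : {set {set 'I_n}} :=
  faces_card (clique_complex G) a.

Definition sets_through a e : {set {set 'I_n}} :=
  [set S : {set 'I_n} | (#|S| == a) && (val e \subset S)]%SET.

Definition cliques_through a e G : {set {set 'I_n}} :=
  [set S in sets_through a e | edges_in S :\ e \subset G]%SET.

Lemma clique_edges_in G S : clique G S = (edges_in S \subset G).
Proof.
apply/forall_inP/fintype.subsetP => [cl e|sub i iS].
  rewrite inE => eS; have /cards2P[x [y [xy exy]]] := valP e.
  have [xS yS] : x \in S /\ y \in S.
    by split; apply: (fintype.subsetP eS); rewrite exy !inE eqxx ?orbT.
  have /forall_inP/(_ y yS) := cl x xS; rewrite xy/= => /existsP[e' /andP[e'G]].
  rewrite -exy => /eqP/val_inj e'e; rewrite e'e in e'G. exact: e'G.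
apply/forall_inP => j jS; apply/implyP => ij; apply/existsP.
have cij : #|[set i; j]%SET| == 2 by rewrite cards2 ij.
exists (Sub [set i; j]%SET cij : edge n); rewrite eqxx andbT; apply: sub; rewrite inE/=.
by rewrite finset.subUset !finset.sub1set iS jS.
Qed.

Lemma cliques_of_sizeE a G : (0 < a)%N ->
  cliques_of_size a G = [set S : {set 'I_n} | (#|S| == a) && (edges_in S \subset G)]%SET.
Proof.
move=> a0; apply/finset.setP => S; rewrite !inE clique_edges_in -card_gt0.
by case: eqVneq => [->|_]; rewrite ?andbF// a0 andbT.
Qed.

Lemma card_edges_in S : #|edges_in S| = 'C(#|S|, 2).
Proof.
rewrite -cards_draws -(card_imset _ val_inj); apply: eq_card => A; rewrite !inE.
apply/imsetP/andP => [[e eS ->]|[AS cA]].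
  by move: eS; rewrite inE => ->; split=> //; exact: (valP e).
by exists (Sub A cA : edge n) => //; rewrite inE.
Qed.

Lemma edges_inI S S' : (edges_in S :&: edges_in S')%SET = edges_in (S :&: S')%SET.
Proof. by apply/finset.setP => e; rewrite !inE finset.subsetI. Qed.

Lemma edges_inD1 e S : ~~ (val e \subset S) -> (edges_in S :\ e)%SET = edges_in S.
Proof.
move=> eS; apply/finset.setP => i; rewrite !inE.
by case: eqVneq => //= ->; rewrite (negPf eS).
Qed.

Lemma cliques_of_size_setU1 a e G : (0 < a)%N ->
  cliques_of_size a (e |: G)%SET =
  (cliques_of_size a (G :\ e)%SET :|: cliques_through a e G)%SET.
Proof.
move=> a0; apply/finset.setP => S; rewrite finset.in_setU !cliques_of_sizeE// !inE.
rewrite finset.subsetD1 finset.subDset inE -!andbA -andb_orr; case: eqP => //= _.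
case eS: (val e \subset S); rewrite ?andbF ?andbT//= orbF -finset.subDset.
by rewrite edges_inD1 ?eS.
Qed.

Lemma cliques_of_size_setD1 a e G : (0 < a)%N ->
  cliques_of_size a (G :\ e)%SET =
  (cliques_of_size a (e |: G) :\: [set S : {set 'I_n} | val e \subset S])%SET.
Proof.
move=> a0; apply/finset.setP => S; rewrite finset.in_setD !cliques_of_sizeE// !inE.
rewrite finset.subsetD1 inE [in RHS]andbCA; case: eqP => //= _.
case eS: (val e \subset S); rewrite ?andbF ?andbT//= -finset.subDset.
by rewrite edges_inD1 ?eS.
Qed.

Lemma card_cliques_setU1 a e G : (0 < a)%N ->
  #|cliques_of_size a (e |: G)%SET| =
  (#|cliques_of_size a (G :\ e)%SET| + #|cliques_through a e G|)%N.
Proof.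
move=> a0; rewrite cliques_of_size_setU1// cardsU (_ : _ :&: _ = finset.set0)%SET ?cards0 ?subn0//.
apply/finset.setP => S; rewrite cliques_of_size_setD1// !inE.
by case: (val e \subset S); rewrite ?andbF.
Qed.

(** Adding one edge adds one row per new clique. *)
Lemma span_rank_setU1 (F : fieldType) (m : nat) (v : {set 'I_n} -> 'rV[F]_m) a e G :
  (0 < a)%N ->
  (span_rank v (cliques_of_size a (G :\ e)%SET) <=
   span_rank v (cliques_of_size a (e |: G)%SET) <=
   span_rank v (cliques_of_size a (G :\ e)%SET) + #|cliques_through a e G|)%N.
Proof.
move=> a0; rewrite cliques_of_size_setU1// span_rankU andbT.
by apply: span_rankS; exact: finset.subsetUl.
Qed.

Lemma sum_span_rank_edge (F : fieldType) (m : nat) (v : {set 'I_n} -> 'rV[F]_m) a G :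
  (0 < a)%N ->
  (\sum_(e in G) (span_rank v (cliques_of_size a G) -
     span_rank v (cliques_of_size a (G :\ e)%SET))
   <= 'C(a, 2) * span_rank v (cliques_of_size a G))%N.
Proof.
move=> a0; rewrite (eq_bigr (fun e : edge n => span_rank v (cliques_of_size a G) -
  span_rank v (cliques_of_size a G :\: [set S : {set 'I_n} | val e \subset S])%SET)%N).
  apply: sum_span_rank_drop => S; rewrite cliques_of_sizeE// inE => /andP[/eqP <- _].
  rewrite -card_edges_in; apply: subset_leq_card; apply/fintype.subsetP => e.
  by rewrite !inE => /andP[].
move=> e eG; rewrite (cliques_of_size_setD1 e G a0).
have /finset.setUidPr -> : [set e]%SET \subset G by rewrite finset.sub1set.
by [].
Qed.

Lemma card_sets_through a e : (2 <= a)%N -> #|sets_through a e| = 'C(n - 2, a - 2).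
Proof.
move=> a2; have -> : (n - 2 = #|~: val e|%SET)%N.
  by have /eqP ce := valP e; rewrite -[n in LHS]card_ord -(cardsC (val e)) ce addKn.
rewrite -cards_draws; set B := [set _ | _]%SET.
have inj : {in B &, injective (fun A => val e :|: A)%SET}.
  move=> A A'; rewrite !inE => /andP[Ae _] /andP[A'e _] E.
  have dd (X : {set 'I_n}) : X \subset (~: val e)%SET -> ((val e :|: X) :\: val e)%SET = X.
    move=> Xe; rewrite finset.setDUl finset.setDv finset.set0U; apply/finset.setDidPl.
    by rewrite finset.disjoints_subset.
  by rewrite -(dd A)// E dd.
rewrite -(card_in_imset inj); apply: eq_card => S; rewrite inE.
apply/andP/imsetP => [[/eqP cS eS]|[A + ->]].
  exists (S :\: val e)%SET; last first.
    by rewrite finset.setDE finset.setUIr finset.setUCr finset.setIT; apply/esym/finset.setUidPr.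
  rewrite inE finset.setDE finset.subsetIr/=.
  by rewrite -finset.setDE cardsD (finset.setIidPr eS) cS (eqP (valP e)).
rewrite inE => /andP[Ae /eqP cA]; split; last exact: finset.subsetUl.
rewrite cardsU cA (eqP (valP e)) (_ : _ :&: _ = finset.set0)%SET ?cards0 ?subn0 ?subnKC//.
by apply/eqP; rewrite finset.setI_eq0 disjoint_sym finset.disjoints_subset.
Qed.

Lemma leq_bin_expn m j : ('C(m, j) <= m ^ j)%N.
Proof.
elim: j m => [|j IH] [|m]; rewrite ?bin0 ?bin0n//.
rewrite -(@leq_pmul2l j.+1)// -mul_bin_diag expnS mulnCA leq_mul2l/=.
apply: (leq_trans (IH m)); apply: (@leq_trans (m.+1 ^ j)); last exact: leq_pmull.
by case: j {IH} => [|j]; rewrite ?expn0// leq_exp2r.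
Qed.

(** A set with given trace [I] on [S] is determined by its vertices outside [S]. *)
Lemma card_sets_with_trace S I a :
  (#|[set S' : {set 'I_n} | (#|S'| == a) && (S' :&: S == I)]%SET| <= n ^ (a - #|I|))%N.
Proof.
apply: (@leq_trans 'C(n, a - #|I|)); last exact: leq_bin_expn.
have -> : 'C(n, a - #|I|) = #|[set A : {set 'I_n} | A \subset [set: 'I_n]%SET & #|A| == (a - #|I|)%N]%SET|.
  by rewrite cards_draws cardsT card_ord.
set B := [set _ | _]%SET.
have inj : {in B &, injective (fun A => A :\: S)%SET}.
  move=> A A'; rewrite !inE => /andP[_ /eqP AI] /andP[_ /eqP AI'] E.
  by rewrite -(finset.setID A S) -(finset.setID A' S) AI AI' E.
rewrite -(card_in_imset inj); apply: subset_leq_card; apply/fintype.subsetP => A.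
case/imsetP => A' + ->; rewrite !inE => /andP[/eqP cA /eqP AI].
by rewrite finset.subsetT/= cardsD AI cA.
Qed.

End clique_counts.

(** * Moments of the number of cliques through an edge *)

Section clique_moments.
Context {R : realType} (n : nat).
Implicit Types (p : R) (e : edge n) (a k : nat).

Lemma bin2_double j : (2 * 'C(j.+2, 2) = j.+2 * j.+1)%N.
Proof. by rewrite -mul_bin_diag/= bin1. Qed.

Lemma leq_sqr_bin2 m : (2 <= m)%N -> (m ^ 2 <= 4 * 'C(m, 2))%N.
Proof.
case: m => [|[|m]]// _; rewrite -[4%N]/(2 * 2)%N -mulnA bin2_double.
by rewrite mulnCA expnS expn1 leq_mul2l/=; lia.
Qed.

(** A pair of sets is charged to the trace of the second set on the first. The first
set can be chosen in at most [n ^ (a - 2)] ways, and its subset in [2 ^ a] ways. *)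
Lemma sum_pairs_through a e (w : nat -> R) (B : R) : (2 <= a)%N ->
  (forall i, 0 <= w i) ->
  (forall i, (2 <= i <= a)%N -> n%:R ^+ (a - i) * w i <= B) ->
  \sum_(S in sets_through a e) \sum_(S' in sets_through a e) w #|S' :&: S|%SET
   <= n%:R ^+ (a - 2) * 2 ^+ a * B.
Proof.
move=> a2 w0 wB.
have B0 : 0 <= B by apply: le_trans (wB 2 _); rewrite ?leqnn// mulr_ge0 ?exprn_ge0.
apply: (@le_trans _ _ (\sum_(S in sets_through a e) 2 ^+ a * B)); last first.
  rewrite sumr_const card_sets_through// -[leLHS]mulr_natl -mulrA ler_wpM2r ?mulr_ge0 ?exprn_ge0//.
  rewrite -natrX ler_nat; apply: leq_trans (leq_bin_expn _ _) _.
  by case: (a - 2)%N => // c; rewrite leq_exp2r// leq_subr.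
apply: ler_sum => S; rewrite inE => /andP[/eqP cS eS].
rewrite (partition_big (fun S' => S' :&: S)%SET (fun I => I \in powerset S))/=; last first.
  by move=> S' _; rewrite powersetE finset.subsetIr.
apply: (@le_trans _ _ (\sum_(I in powerset S) B)); last first.
  by rewrite sumr_const card_powerset cS -[leLHS]mulr_natl natrX.
apply: ler_sum => I IS.
have [/existsP[S1 /andP[S1t /eqP S1I]]|/existsPn no] := boolP [exists S' : {set 'I_n},
    (S' \in sets_through a e) && (S' :&: S == I)%SET]; last first.
  by rewrite big_pred0// => S'; apply/negbTE/no.
have I2 : (2 <= #|I| <= a)%N.
  move: S1t; rewrite inE => /andP[/eqP cS1 eS1].
  rewrite -S1I -cS1 subset_leq_card ?finset.subsetIl// andbT.
  rewrite -(eqP (valP e)) subset_leq_card// finset.subsetI eS1 //.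
rewrite (eq_bigr (fun=> w #|I|)); last by move=> S' /andP[_ /eqP ->].
rewrite sumr_const; apply: le_trans (wB _ I2); rewrite -[leLHS]mulr_natl ler_wpM2r//.
rewrite -natrX ler_nat; apply: leq_trans (card_sets_with_trace S I a).
apply: subset_leq_card; apply/fintype.subsetP => S'; rewrite !inE unfold_in/= inE.
by move=> /andP[/andP[-> _] ->].
Qed.

Lemma card_edges_through a e S : S \in sets_through a e ->
  #|edges_in S :\ e|%SET = 'C(a, 2).-1.
Proof.
rewrite inE => /andP[/eqP cS eS]; have := card_edges_in S.
by rewrite cS (cardsD1 e) inE eS add1n => <-.
Qed.

Lemma card_edges_throughU a e S S' : S \in sets_through a e -> S' \in sets_through a e ->
  #|(edges_in S :\ e) :|: (edges_in S' :\ e)|%SET =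
  (2 * 'C(a, 2).-1 - 'C(#|S' :&: S|%SET, 2).-1)%N.
Proof.
move=> St S't; have := cardsUI (edges_in S :\ e)%SET (edges_in S' :\ e)%SET.
have SSt : (S' :&: S)%SET \in sets_through #|S' :&: S|%SET e.
  by move: St S't; rewrite !inE finset.subsetI eqxx => /andP[_ ->] /andP[_ ->].
have -> : ((edges_in S :\ e) :&: (edges_in S' :\ e) = edges_in (S' :&: S) :\ e)%SET.
  rewrite -edges_inI; apply/finset.setP => i; rewrite !inE.
  by case: (i == e); rewrite //= andbC.
rewrite (card_edges_through SSt) (card_edges_through St) (card_edges_through S't).
by move=> /eqP; rewrite addnn -mul2n => /eqP <-; rewrite addnK.
Qed.

Lemma mean_cliques_through p a e : (2 <= a)%N ->
  mean p (fun G => #|cliques_through a e G|%:R) = 'C(n - 2, a - 2)%:R * p ^+ 'C(a, 2).-1.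
Proof.
move=> a2; rewrite (mean_count p (fun S => edges_in S :\ e)%SET).
rewrite (eq_bigr (fun=> p ^+ 'C(a, 2).-1)); first by rewrite sumr_const card_sets_through// mulr_natl.
by move=> S St; rewrite (card_edges_through St).
Qed.

Lemma mean_cliques_through_sqr p a e : (2 <= a)%N ->
  mean p (fun G => #|cliques_through a e G|%:R ^+ 2) =
  \sum_(S in sets_through a e) \sum_(S' in sets_through a e)
    p ^+ (2 * 'C(a, 2).-1 - 'C(#|S' :&: S|%SET, 2).-1).
Proof.
move=> a2; rewrite (mean_count_sqr p (fun S => edges_in S :\ e)%SET).
by apply: eq_bigr => S St; apply: eq_bigr => S' S't; rewrite (card_edges_throughU St S't).
Qed.

Lemma mean_cliques_of_size p a : (0 < a)%N ->
  mean p (fun G => #|cliques_of_size a G : {set {set 'I_n}}|%:R) = 'C(n, a)%:R * p ^+ 'C(a, 2).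
Proof.
move=> a0; pose J := [set S : {set 'I_n} | #|S| == a]%SET.
transitivity (mean p (fun G => #|[set S in J | edges_in S \subset G]%SET|%:R)).
  apply: eq_mean => G; rewrite cliques_of_sizeE//; congr (_%:R); apply: eq_card => S.
  by rewrite !inE.
rewrite mean_count (eq_bigr (fun=> p ^+ 'C(a, 2))); last first.
  by move=> S; rewrite inE card_edges_in => /eqP ->.
rewrite sumr_const -[LHS]mulr_natl; congr (_%:R * _).
have := cards_draws [set: 'I_n]%SET a; rewrite cardsT card_ord => <-.
by apply: eq_card => S; rewrite !inE finset.subsetT.
Qed.

Section regime.
Variables (p : R) (k : nat) (e : edge n).
Hypotheses (n0 : (0 < n)%N) (k0 : (0 < k)%N) (p0 : 0 < p) (p1 : p <= 1).
Hypothesis u1 : 1 <= n%:R * p ^+ k.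

Local Notation u := (n%:R * p ^+ k).
Local Notation x := (n%:R * p ^+ k.+1).
Local Notation q := ('C(k.+1, 2).-1).
Local Notation M0 := (n%:R ^+ k.-1 * p ^+ q).

(** Sharing [j] vertices besides an edge means sharing [j (j + 3) / 2] further
edges, which is at most [j k] when [j < k]. *)
Lemma overlap_ge j : (j < k)%N -> u ^+ j <= n%:R ^+ j * p ^+ 'C(j.+2, 2).-1.
Proof.
move=> jk; rewrite exprMn -exprM ler_wpM2l ?exprn_ge0//.
apply: ler_wiXn2l; rewrite ?p1 ?(ltW p0)//.
have := bin2_double j; nia.
Qed.

(** Sets that share only the edge [e] contribute independent events; by
[overlap_ge] each further shared vertex costs a factor [n p^k]. *)
Lemma variance_cliques_through :
  variance p (fun G => #|cliques_through k.+1 e G|%:R) * u <= 2 ^+ k.+1 * M0 ^+ 2.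
Proof.
pose w i := if (i <= 2)%N then 0 else p ^+ (2 * q - 'C(i, 2).-1).
have w0 i : 0 <= w i by rewrite /w; case: ifP => // _; rewrite exprn_ge0// ltW.
have le1 : variance p (fun G => #|cliques_through k.+1 e G|%:R) <=
    \sum_(S in sets_through k.+1 e) \sum_(S' in sets_through k.+1 e) w #|S' :&: S|%SET.
  rewrite varianceE mean_cliques_through_sqr// (mean_count p (fun S => edges_in S :\ e)%SET).
  rewrite expr2 mulr_suml -sumrB; apply: ler_sum => S St.
  rewrite mulr_sumr -sumrB; apply: ler_sum => S' S't.
  rewrite (card_edges_through St) (card_edges_through S't) /w.
  case: ifP => i2; last by rewrite gerBl mulr_ge0// exprn_ge0// ltW.
  have -> : #|S' :&: S|%SET = 2%N.
    apply/eqP; rewrite eqn_leq i2/= -(eqP (valP e)) subset_leq_card//.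
    by move: St S't; rewrite !inE finset.subsetI => /andP[_ ->] /andP[_ ->].
  by rewrite subn0 mul2n -addnn exprD subrr.
apply: le_trans (ler_wpM2r _ le1) _; first exact: le_trans u1.
have up : 0 < u by exact: lt_le_trans u1.
pose B := n%:R ^+ k.-1 * p ^+ (2 * q) / u.
have le2 : \sum_(S in sets_through k.+1 e) \sum_(S' in sets_through k.+1 e)
    w #|S' :&: S|%SET <= n%:R ^+ (k.+1 - 2) * 2 ^+ k.+1 * B.
  apply: sum_pairs_through => //; case=> [|[|[|j]]]//= jk; rewrite /w/= ?mulr0.
    by rewrite divr_ge0// ?mulr_ge0 ?exprn_ge0// ltW.
  rewrite ler_pdivlMr// subSS.
  have jk' : (j.+1 < k)%N by lia.
  have := overlap_ge jk'; set b := 'C(_, 2).-1 => ov.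
  have bq : (b <= 2 * q)%N.
    rewrite /b; have := bin2_double j.+1; have := bin2_double k.-1; rewrite prednK//; nia.
  have -> : n%:R ^+ k.-1 * p ^+ (2 * q) =
      n%:R ^+ (k - j.+2) * p ^+ (2 * q - b) * (n%:R ^+ j.+1 * p ^+ b) :> R.
    have -> : k.-1 = ((k - j.+2) + j.+1)%N by lia.
    by rewrite exprD -{1}(subnK bq) exprD; ring.
  apply: ler_wpM2l; first by rewrite mulr_ge0 ?exprn_ge0// ltW.
  apply: le_trans ov; rewrite exprS ler_peMr ?exprn_ege1// ltW//.
apply: le_trans (ler_wpM2r (ltW up) le2) _.
rewrite subSS subn1 /B mulrA divfK ?gt_eqF// exprMn -!exprM (mulnC q).
by rewrite le_eqVlt; apply/orP; left; apply/eqP; rewrite muln2 -addnn exprD; ring.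
Qed.

(** The first summand accounts for the pairs of distinct sets, to which [overlap_ge]
applies. It does not apply to pairs of equal sets, which give the second
summand. *)
Lemma mean_sqr_cliques_through_succ :
  mean p (fun G => #|cliques_through k.+2 e G|%:R ^+ 2) <=
  2 ^+ k.+2 * M0 ^+ 2 * (x ^+ 2 + x).
Proof.
have q2 : 'C(k.+2, 2).-1 = (q + k.+1)%N.
  have := bin2_double k; have := bin2_double k.-1; rewrite prednK//; nia.
rewrite mean_cliques_through_sqr//.
pose w i := p ^+ (2 * 'C(k.+2, 2).-1 - 'C(i, 2).-1).
have w0 i : 0 <= w i by rewrite exprn_ge0// ltW.
(* Both summands of the target, divided by the number of choices of the first set. *)
pose B := n%:R ^+ k * p ^+ (2 * 'C(k.+2, 2).-1) + n%:R ^+ k.-1 * p ^+ (q + 'C(k.+2, 2).-1).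
apply: le_trans (_ : n%:R ^+ (k.+2 - 2) * 2 ^+ k.+2 * B <= _).
  apply: (@sum_pairs_through k.+2 e w) => // -[|[|j]]// jk; rewrite subSS.
  have [jk'|jk'] := ltnP j k.
    rewrite /B; apply: ler_wpDr; first by rewrite mulr_ge0 ?exprn_ge0// ltW.
    have := overlap_ge jk'; rewrite /w; set b := 'C(j.+2, 2).-1 => ov.
    have bq : (b <= 2 * 'C(k.+2, 2).-1)%N.
      rewrite /b; have := bin2_double j; have := bin2_double k; nia.
    have -> : n%:R ^+ k * p ^+ (2 * 'C(k.+2, 2).-1) =
        n%:R ^+ (k.+1 - j.+1) * p ^+ (2 * 'C(k.+2, 2).-1 - b) * (n%:R ^+ j * p ^+ b) :> R.
      rewrite -{1}(subnK bq) exprD subSS -{1}(subnK (ltnW jk')) exprD; ring.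
    rewrite ler_peMr ?mulr_ge0 ?exprn_ge0 ?(ltW p0)//.
    by apply: le_trans ov; rewrite exprn_ege1.
  have -> : j = k by lia.
  rewrite subnn expr0 mul1r /B; apply: ler_wpDl; first by rewrite mulr_ge0 ?exprn_ge0// ltW.
  rewrite /w mul2n -addnn addnK exprD mulrA ler_peMl ?exprn_ge0 ?(ltW p0)//.
  apply: le_trans (_ : u ^+ k.-1 <= _); first exact: exprn_ege1.
  rewrite exprMn -exprM ler_wpM2l ?exprn_ge0//; apply: ler_wiXn2l; rewrite ?p1 ?(ltW p0)//.
  by have := bin2_double k.-1; rewrite prednK//; nia.
have -> : (k.+2 - 2 = k)%N by lia.
rewrite le_eqVlt; apply/orP; left; apply/eqP; rewrite /B q2 -[in n%:R ^+ k](prednK k0).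
rewrite mulnDr [(2 * q)%N]mul2n -addnn [(2 * k.+1)%N]mul2n -addnn !exprD !exprS.
by ring.
Qed.

End regime.
End clique_moments.

(** * The linear part of the Betti number *)

Section betti_fluctuations.
Context {R : realType} (n : nat).
Implicit Types (p : R) (e : edge n) (a k : nat) (G : {set edge n}).

Definition boundary_rank a G : R :=
  (span_rank (@boundary_row n) (cliques_of_size a G))%:R.

Lemma influence_boundary_rank a e G : (0 < a)%N ->
  0 <= influence e (boundary_rank a) G <= #|cliques_through a e G|%:R.
Proof.
move=> a0; rewrite /influence /boundary_rank subr_ge0 lerBlDl -natrD !ler_nat.
exact: span_rank_setU1.
Qed.

(** The rank drop caused by an edge is at most the number of basis cliques
through it, and each clique is charged by its own edges only; so the rank itself,
hence the number of cliques one dimension lower, controls the total. *)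
Lemma sum_mean_influence_boundary_rank p k : 0 <= p <= 1 -> (0 < k)%N ->
  p * \sum_e mean p (influence e (boundary_rank k.+1)) <=
  'C(k.+1, 2)%:R * ('C(n, k)%:R * p ^+ 'C(k, 2)).
Proof.
move=> p01 k0; rewrite mulr_sumr; under eq_bigr do rewrite mean_influence.
rewrite -mean_sum -mean_cliques_of_size// -meanZ; apply: le_mean => // G.
apply: (@le_trans _ _ ('C(k.+1, 2) * span_rank (@boundary_row n) (cliques_of_size k.+1 G))%:R).
  apply: le_trans (_ : (\sum_(e in G) (span_rank (@boundary_row n) (cliques_of_size k.+1 G) -
     span_rank (@boundary_row n) (cliques_of_size k.+1 (G :\ e)%SET)))%:R <= _); last first.
    by rewrite ler_nat sum_span_rank_edge.
  rewrite natr_sum [leRHS]big_mkcond/=; apply: ler_sum => e _.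
  case: ifP => eG; last by rewrite mul0r.
  rewrite mul1r /boundary_rank natrB//.
  by have /andP[] := span_rank_setU1 (@boundary_row n) e G (ltn0Sn k);
    rewrite (finset.setUidPr _) ?finset.sub1set.
rewrite natrM ler_wpM2l// ler_nat.
exact: (span_rank_boundary_le (clique_complex G) k0).
Qed.

Lemma card_edge : #|{: edge n}| = 'C(n, 2).
Proof.
have := cards_draws [set: 'I_n]%SET 2; rewrite cardsT card_ord => <-.
by rewrite card_sig; apply: eq_card => A; rewrite !inE finset.subsetT.
Qed.

Lemma leq_subn_ffact m j : ((m.+1 - j) ^ j <= m ^_ j)%N.
Proof.
elim: j => [|j IH]; first by rewrite ffactn0.
rewrite expnSr ffactnSr subSS leq_mul2r; apply/orP; right; apply: leq_trans IH.
by case: j => // j; rewrite leq_exp2r//; lia.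
Qed.

Lemma expn_leq_bin k : (0 < k)%N -> (2 * k <= n)%N ->
  (n ^ k.-1 <= 2 ^ k.-1 * (k.-1)`! * 'C(n - 2, k.-1))%N.
Proof.
move=> k0 kn; rewrite -mulnA [(_`! * _)%N]mulnC bin_ffact.
apply: leq_trans (_ : 2 ^ k.-1 * (n - k) ^ k.-1 <= _)%N.
  rewrite -expnMn; case: k k0 kn => // -[|k] _ kn; rewrite ?expn0// leq_exp2r//=; lia.
rewrite leq_mul2l; apply/orP; right; apply: leq_trans (leq_subn_ffact _ _).
by apply: leq_trans (_ : (n - k) ^ k.-1 <= _)%N => //; rewrite (_ : (n - 2).+1 - k.-1 = n - k)%N//; lia.
Qed.

(** The mean number of cliques with [k + 1] vertices completed by a given edge, which
makes the number of edges times this constant the linear part of [beta]. *)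
Definition edge_coefficient p k : R := 'C(n - 2, k.-1)%:R * p ^+ ('C(k.+1, 2)).-1.

Lemma influence_card e G : influence e (fun G => #|G|%:R) G = 1 :> R.
Proof.
rewrite /influence cardsU1 (cardsD1 e G) -natrB; last by case: (e \in G).
by case: (e \in G); rewrite /= !(add0n, add1n) ?subSnn// subSn// subnn.
Qed.

Lemma influence_betti p k e G : (0 < k)%N ->
  influence e (fun G => betti_rv k n G - edge_coefficient p k * #|G|%:R) G =
  #|cliques_through k.+1 e G|%:R - edge_coefficient p k -
  influence e (boundary_rank k.+1) G - influence e (boundary_rank k.+2) G.
Proof.
move=> k0.
have E H : betti_rv k n H = #|cliques_of_size k.+1 H|%:R - boundary_rank k.+1 H
    - boundary_rank k.+2 H :> R.
  have := congr1 (fun m => m%:R : R) (betti_rank (clique_complex H) k0).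
  by rewrite !natrD /betti_rv /boundary_rank /cliques_of_size => <-; ring.
have c1 : edge_coefficient p k = edge_coefficient p k * (#|e |: G|%SET%:R - #|G :\ e|%SET%:R).
  by have := influence_card e G; rewrite /influence => ->; rewrite mulr1.
have regroup (c f h r1 r0 s1 s0 x y : R) : c = c * (x - y) ->
    f + h - r1 - s1 - c * x - (f - r0 - s0 - c * y) = h - c - (r1 - r0) - (s1 - s0).
  by move=> cE; rewrite [in RHS]cE; ring.
by rewrite /influence !E card_cliques_setU1// natrD; exact: regroup.
Qed.

(** Write [M] for the number of cliques with [k + 1] vertices completed by [e], and [d]
for the influence of [e] on the rank of the outgoing boundary map, so that
[d <= M]. Replacing [d] by [M] would lose too much, so [d] is kept to the first
power as long as [M <= 2 c]; otherwise [M <= 2 (M - c)]. *)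
Lemma sqr_influence_betti p k e G : 0 <= p -> (0 < k)%N ->
  influence e (fun G => betti_rv k n G - edge_coefficient p k * #|G|%:R) G ^+ 2 <=
  15 * (#|cliques_through k.+1 e G|%:R - edge_coefficient p k) ^+ 2 +
  6 * edge_coefficient p k * influence e (boundary_rank k.+1) G +
  3 * #|cliques_through k.+2 e G|%:R ^+ 2.
Proof.
move=> p0 k0; rewrite influence_betti//.
set c := edge_coefficient p k; set M : R := #|cliques_through k.+1 e G|%:R.
have /andP[] := influence_boundary_rank e G (ltn0Sn k); rewrite -/M.
have /andP[] := influence_boundary_rank e G (ltn0Sn k.+1).
set N := _%:R; set d := influence _ _ _; set d' := influence _ _ _ => d0 dN d'0 dM.
have c0 : 0 <= c by rewrite mulr_ge0// exprn_ge0.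
have dsqr : d' ^+ 2 <= 2 * c * d' + 4 * (M - c) ^+ 2.
  have [Mc|Mc] := lerP M (2 * c).
    have : 0 <= d' * (2 * c - d') by rewrite mulr_ge0// subr_ge0 (le_trans dM).
    by have := sqr_ge0 (M - c); lra.
  have : 0 <= (M - 2 * c) * (3 * M - 2 * c) by rewrite mulr_ge0//; lra.
  have : 0 <= (M - d') * (M + d') by rewrite mulr_ge0//; lra.
  by have := mulr_ge0 c0 d'0; lra.
have dsqr' : d ^+ 2 <= N ^+ 2 by rewrite ler_pXn2r ?nnegrE// (le_trans d0).
have := sqr_ge0 (M - c + d'); have := sqr_ge0 (M - c + d); have := sqr_ge0 (d' - d).
by nra.
Qed.

End betti_fluctuations.

(** The three error terms come from the fluctuation of the number of cliques
completed by an edge together with the rank of the outgoing boundary map (first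
term), and from the rank of the incoming boundary map (the other two). *)
Lemma variance_betti_sub_edges (R : realType) (k : nat) : (0 < k)%N ->
  exists K : R, forall (n : nat) (p : R), (2 * k <= n)%N -> 0 < p <= 1 ->
  1 <= n%:R * p ^+ k ->
  variance p (fun G : {set edge n} => betti_rv k n G - edge_coefficient n p k * #|G|%:R) <=
  K * ((n%:R * p ^+ k)^-1 + n%:R * p ^+ k.+1 + (n%:R * p ^+ k.+1) ^+ 2) *
  (edge_coefficient n p k ^+ 2 * variance p (fun G : {set edge n} => #|G|%:R)).
Proof.
move=> k0; pose b : R := 'C(k.+1, 2)%:R; pose L : R := (2 ^ k.-1 * (k.-1)`!)%:R.
pose K1 : R := 15 * 2 ^+ k.+1 + 24 * b + 3 * 2 ^+ k.+2.
exists (L ^+ 2 * K1) => n p kn /andP[p0 p1] u1.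
have p01 : 0 <= p <= 1 by rewrite ltW.
set c := edge_coefficient n p k; set u := n%:R * p ^+ k; set x := n%:R * p ^+ k.+1.
pose M0 : R := n%:R ^+ k.-1 * p ^+ ('C(k.+1, 2)).-1; pose m : R := 'C(n, 2)%:R.
have n0 : (0 < n)%N by lia.
have up : 0 < u := lt_le_trans ltr01 u1.
have b0 : 0 <= b by []. have m0 : 0 <= m by [].
have x0 : 0 <= x by rewrite mulr_ge0// exprn_ge0// ltW.
have c0 : 0 <= c by rewrite mulr_ge0// exprn_ge0// ltW.
have M00 : 0 <= M0 by rewrite mulr_ge0// exprn_ge0// ltW.
have cM : c <= M0.
  rewrite ler_wpM2r ?exprn_ge0 ?(ltW p0)// -natrX ler_nat; apply: leq_trans (leq_bin_expn _ _) _.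
  by case: (k.-1) => // j; rewrite leq_exp2r// leq_subr.
have Mc : M0 <= L * c.
  rewrite /M0 /c /edge_coefficient mulrA ler_wpM2r ?exprn_ge0 ?(ltW p0)//.
  by rewrite -natrX -natrM ler_nat; exact: expn_leq_bin.
have q1 : ('C(k.+1, 2) = 'C(k, 2) + k)%N by rewrite binS bin1.
have q2 : ('C(k.+1, 2).-1.+1 = 'C(k.+1, 2))%N by rewrite prednK// bin_gt0.
have n2m : n%:R ^+ 2 <= 4 * m.
  have : (n ^ 2 <= 4 * 'C(n, 2))%N 
    by apply: leq_sqr_bin2; apply: leq_trans kn; rewrite -[X in (X <= _)%N]muln1 leq_mul2l.
  by rewrite -(ler_nat R) natrM natrX.
have bd : p * \sum_e mean p (influence e (@boundary_rank R n k.+1)) <= 4 * b * M0 * m * p / u.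
  apply: le_trans (sum_mean_influence_boundary_rank n p01 k0) _.
  rewrite ler_pdivlMr// -/b.
  apply: le_trans (_ : b * (n%:R ^+ k * p ^+ 'C(k, 2)) * u <= _).
    rewrite ler_wpM2r ?(ltW up)// ler_wpM2l// ler_wpM2r ?exprn_ge0 ?(ltW p0)//.
    by rewrite -natrX ler_nat leq_bin_expn.
  have -> : b * (n%:R ^+ k * p ^+ 'C(k, 2)) * u = b * M0 * p * n%:R ^+ 2.
    transitivity (b * n%:R ^+ k.+1 * p ^+ ('C(k, 2) + k)); first by rewrite exprD exprS /u; ring.
    by rewrite -q1 -q2 -{1}(prednK k0) !exprS /M0; ring.
  have -> : 4 * b * M0 * m * p = b * M0 * p * (4 * m) by ring.
  exact: (ler_wpM2l (mulr_ge0 (mulr_ge0 b0 M00) (ltW p0)) n2m).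
apply: le_trans (efron_stein p01 _) _; rewrite variance_card card_edge -/m.
have sumle : \sum_e mean p (fun G : {set edge n} =>
      influence e (fun G => betti_rv k n G - c * #|G|%:R) G ^+ 2) <=
    15 * (m * (2 ^+ k.+1 * M0 ^+ 2 / u)) +
    6 * c * \sum_e mean p (influence e (@boundary_rank R n k.+1)) +
    3 * (m * (2 ^+ k.+2 * M0 ^+ 2 * (x ^+ 2 + x))).
  have sm (y : R) : m * y = \sum_(e : edge n) y by rewrite sumr_const card_edge mulr_natl.
  rewrite !sm !mulr_sumr -!big_split/=; apply: ler_sum => e _.
  apply: le_trans (_ : mean p (fun G => 15 * (#|cliques_through k.+1 e G|%:R - c) ^+ 2 +
     6 * c * influence e (boundary_rank k.+1) G + 3 * #|cliques_through k.+2 e G|%:R ^+ 2) <= _).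
    by apply: le_mean => // G; apply: sqr_influence_betti => //; exact: ltW.
  rewrite 2!meanD !meanZ; apply: lerD; first apply: lerD => //.
    rewrite ler_wpM2l// ler_pdivlMr//.
    apply: le_trans (variance_cliques_through _ n0 k0 p0 p1 u1).
    by rewrite /variance mean_cliques_through// subSS subn1.
  rewrite ler_wpM2l//; exact: (mean_sqr_cliques_through_succ e n0 k0 p0 p1 u1).
have p10 : 0 <= 1 - p by rewrite subr_ge0.
apply: le_trans (_ : (1 - p) * (15 * (m * p * (2 ^+ k.+1 * M0 ^+ 2 / u)) +
    6 * M0 * (4 * b * M0 * m * p / u) +
    3 * (m * p * (2 ^+ k.+2 * M0 ^+ 2 * (x ^+ 2 + x)))) <= _).
  rewrite mulrAC mulrC ler_wpM2l//.
  apply: le_trans (ler_wpM2l (ltW p0) sumle) _; rewrite !mulrDr.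
  apply: lerD; first apply: lerD; try by rewrite le_eqVlt; apply/orP; left; apply/eqP; ring.
  rewrite (_ : p * (6 * c * _) = 6 * c * (p * \sum_e mean p (influence e (@boundary_rank R n k.+1)))); last by ring.
  apply: le_trans (ler_wpM2l _ bd) _; first by rewrite mulr_ge0.
  apply: ler_wpM2r; last by rewrite ler_wpM2l.
  apply: divr_ge0 (ltW up); apply: mulr_ge0 (ltW p0).
  exact: mulr_ge0 (mulr_ge0 (mulr_ge0 (ler0n _ 4) b0) M00) m0.
have pmp : 0 <= (1 - p) * m * p := mulr_ge0 (mulr_ge0 p10 m0) (ltW p0).
have e1 : 0 <= 2 ^+ k.+1 :> R by rewrite exprn_ge0.
have e2 : 0 <= 2 ^+ k.+2 :> R by rewrite exprn_ge0.
have ui : 0 <= u^-1 by rewrite invr_ge0 ltW.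
apply: le_trans (_ : M0 ^+ 2 * ((1 - p) * m * p * (K1 * (u^-1 + x + x ^+ 2))) <= _).
  rewrite [leLHS](_ : _ = M0 ^+ 2 * ((1 - p) * m * p *
    ((15 * 2 ^+ k.+1 + 24 * b) * u^-1 + 3 * 2 ^+ k.+2 * (x ^+ 2 + x)))); last by ring.
  apply: (ler_wpM2l (sqr_ge0 _)); apply: (ler_wpM2l pmp).
  have x20 := sqr_ge0 x.
  by rewrite /K1; nra.
have K10 : 0 <= K1 by rewrite /K1; lra.
have -> : L ^+ 2 * K1 * (u^-1 + x + x ^+ 2) * (c ^+ 2 * (m * p * (1 - p))) =
  (L * c) ^+ 2 * ((1 - p) * m * p * (K1 * (u^-1 + x + x ^+ 2))) by ring.
apply: ler_wpM2r.
  exact: mulr_ge0 pmp (mulr_ge0 K10 (addr_ge0 (addr_ge0 ui x0) (sqr_ge0 x))).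
have L0 : 0 <= L by exact: ler0n.
by rewrite ler_pXn2r// nnegrE//; exact: mulr_ge0 L0 c0.
Qed.

(** * Taylor expansion of the Gaussian kernel *)

Section taylor.
Context {R : realType}.
Implicit Types (f : R -> R) (C : R).

(** The Taylor estimates are stated on the unit interval, with the size of the
displacement absorbed in the derivatives: displacements of either sign are then
treated alike. *)
Lemma taylor1_le f f1 C (y : R) : 0 <= y <= 1 ->
  (forall t : R, 0 <= t <= 1 -> is_derive t 1 f (f1 t)) ->
  (forall t : R, 0 <= t <= 1 -> `|f1 t| <= C) -> `|f y - f 0| <= C.
Proof.
move=> /andP[y0 y1] df f1C.
have inI c : c \in `[0, y] -> 0 <= c <= 1.
  by rewrite in_itv/= => /andP[-> cy]; exact: le_trans cy y1.
have [c /inI c01 ->] : exists2 c, c \in `[0, y]%R & f y - f 0 = f1 c * (y - 0).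
  apply: MVT_segment => // [c /subset_itv_oo_cc/inI|]; first exact: df.
  apply: derivable_within_continuous => c /inI c01.
  by have := df _ c01; case.
rewrite subr0 normrM (ger0_norm y0) (le_trans _ (f1C c c01))//.
by rewrite ler_piMr.
Qed.

Lemma taylor2_le f f1 f2 C (y : R) : 0 <= y <= 1 ->
  (forall t : R, 0 <= t <= 1 -> is_derive t 1 f (f1 t)) ->
  (forall t : R, 0 <= t <= 1 -> is_derive t 1 f1 (f2 t)) ->
  (forall t : R, 0 <= t <= 1 -> `|f2 t| <= C) ->
  `|f y - f 0 - y * f1 0| <= C.
Proof.
move=> y01 df df1 f2C.
have := @taylor1_le (fun t => f t - t * f1 0) (fun t => f1 t - f1 0) C y y01.
rewrite mul0r subr0 addrAC; apply.
- move=> t t01; have dft := df t t01; apply: is_deriveB.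
  rewrite -[X in is_derive _ _ _ X]mul1r mulrC.
  have := @is_deriveZ R R^o R^o id (f1 0) t 1 1 (is_derive_id _ _).
  by congr (is_derive _ _ _ _); apply/funext => z /=; rewrite mulrC.
- by move=> t t01; apply: taylor1_le df1 f2C.
Qed.

Lemma taylor3_le f f1 f2 f3 C (y : R) : 0 <= y <= 1 ->
  (forall t : R, 0 <= t <= 1 -> is_derive t 1 f (f1 t)) ->
  (forall t : R, 0 <= t <= 1 -> is_derive t 1 f1 (f2 t)) ->
  (forall t : R, 0 <= t <= 1 -> is_derive t 1 f2 (f3 t)) ->
  (forall t : R, 0 <= t <= 1 -> `|f3 t| <= C) ->
  `|f y - f 0 - y * f1 0 - y ^+ 2 / 2 * f2 0| <= C.
Proof.
move=> y01 df df1 df2 f3C.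
have := @taylor1_le (fun t => f t - t * f1 0 - t ^+ 2 / 2 * f2 0)
  (fun t => f1 t - f1 0 - t * f2 0) C y y01.
rewrite mul0r expr0n/= !mul0r !subr0 (_ : f y - _ - _ - f 0 = f y - f 0 - y * f1 0 - y ^+ 2 / 2 * f2 0); last by ring.
apply.
- move=> t t01; have dft := df t t01; apply: is_deriveB; last first.
    by apply: is_derive_eq; rewrite /GRing.scale/=; field.
  by apply: is_deriveB; apply: is_derive_eq; rewrite /GRing.scale/=; ring.
- by move=> t t01; apply: taylor2_le df1 df2 f3C.
Qed.

End taylor.

Section gaussian_kernel.
Context {R : realType}.
Implicit Types u v x y t : R.

(** Up to the factor [1 / sqrt (2 pi)], the centred normal density of variance [u],
written so that it is visibly smooth in [u]. *)
Definition gkernel u x : R := expR (- (2^-1 * ln u) - 2^-1 * x ^+ 2 * u^-1).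

Definition gkernel1 u x : R := - (x * u^-1) * gkernel u x.
Definition gkernel2 u x : R := (x ^+ 2 * u^-1 ^+ 2 - u^-1) * gkernel u x.
Definition gkernel3 u x : R := (3 * x * u^-1 ^+ 2 - x ^+ 3 * u^-1 ^+ 3) * gkernel u x.

(** The second derivative in the variance. *)
Definition gkernel22 u x : R :=
  ((2^-1 * x ^+ 2 * u^-1 ^+ 2 - 2^-1 * u^-1) ^+ 2 +
   2^-1 * u^-1 ^+ 2 - x ^+ 2 * u^-1 ^+ 3) * gkernel u x.

Lemma is_derive_expR_comp (g : R -> R) x d :
  is_derive x 1 g d -> is_derive x 1 (fun y => expR (g y)) (d * expR (g x)).
Proof. by move=> dg; rewrite mulrC; exact: is_derive1_comp. Qed.

Lemma is_derive_gkernel u x : is_derive x 1 (gkernel u) (gkernel1 u x).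
Proof.
rewrite /gkernel1 /gkernel; apply: is_derive_expR_comp.
by apply: is_derive_eq; rewrite /GRing.scale/=; move: u^-1 => w; field.
Qed.

Lemma is_derive_gkernel1 u x : is_derive x 1 (gkernel1 u) (gkernel2 u x).
Proof.
have dk := is_derive_gkernel u x; rewrite /gkernel1.
by apply: is_derive_eq; rewrite /GRing.scale/= /gkernel2 /gkernel1; ring.
Qed.

Lemma is_derive_gkernel2 u x : is_derive x 1 (gkernel2 u) (gkernel3 u x).
Proof.
have dk := is_derive_gkernel u x; rewrite /gkernel2.
by apply: is_derive_eq; rewrite /GRing.scale/= /gkernel3 /gkernel1; ring.
Qed.

Lemma is_derive_inv u : 0 < u -> is_derive u 1 (fun u : R => u^-1) (- u^-1 ^+ 2).
Proof.
move=> u0; have := @is_deriveV R id u 1 1 (lt0r_neq0 u0) (is_derive_id _ _).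
by rewrite /GRing.scale/= mulr1 exprVn.
Qed.

(** The kernel solves the heat equation, whence the second space derivative. *)
Lemma is_derive_gkernel_variance u x : 0 < u ->
  is_derive u 1 (gkernel ^~ x) (2^-1 * gkernel2 u x).
Proof.
move=> u0; have dl := is_derive1_ln u0; have di := is_derive_inv u0.
rewrite /gkernel2 mulrA /gkernel; apply: is_derive_expR_comp.
by apply: is_derive_eq; rewrite /GRing.scale/=; ring.
Qed.

Lemma is_derive_gkernel2_variance u x : 0 < u ->
  is_derive u 1 (fun u => 2^-1 * gkernel2 u x) (gkernel22 u x).
Proof.
move=> u0; have dk := is_derive_gkernel_variance x u0; have di := is_derive_inv u0.
rewrite /gkernel2.
by apply: is_derive_eq; rewrite /GRing.scale/= /gkernel22 /gkernel2; move: u^-1 (gkernel _ _) => w z; field.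
Qed.

End gaussian_kernel.

Section gaussian_kernel_taylor.
Context {R : realType}.
Implicit Types u v x y t s : R.

Lemma exprn_expRN_le n y : 0 <= y -> y ^+ n * expR (- y) <= n`!%:R.
Proof.
move=> y0; rewrite expRN ler_pdivrMr ?expR_gt0//.
case: n => [|n]; first by rewrite expr0 mul1r (le_trans _ (expR_ge1Dx y))// lerDl.
rewrite mulrC -ler_pdivrMr ?ltr0n ?fact_gt0//.
by apply: le_trans (expR_ge1Dxn n y0); rewrite lerDr.
Qed.

(** In terms of [y = x^2 / (2 u)] the derivatives are polynomials in [y] times
[exp (- y)], up to powers of [1 / u] and of [x], and [y^n exp (- y) <= n!]. *)
Lemma gkernel_derivatives_bounded v : 0 < v ->
  exists2 C, 0 <= C & forall u x, v <= u ->
    `|gkernel3 u x| <= C /\ `|gkernel22 u x| <= C.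
Proof.
move=> v0; pose E := expR (- (2^-1 * ln v)); pose V := v^-1.
have V0 : 0 < V by rewrite invr_gt0.
have E0 : 0 < E by exact: expR_gt0.
exists (19 * (V ^+ 2 + V) * E) => [|u x vu].
  by rewrite !mulr_ge0 ?addr_ge0 ?exprn_ge0// ltW.
have u0 : 0 < u by exact: lt_le_trans vu.
pose w := u^-1; pose y := 2^-1 * x ^+ 2 * w; pose k := gkernel u x.
have w0 : 0 < w by rewrite invr_gt0.
have wV : w <= V by rewrite lef_pV2.
have y0 : 0 <= y by rewrite mulr_ge0 ?(ltW w0)// mulr_ge0 ?sqr_ge0.
have k0 : 0 < k by exact: expR_gt0.
have yk n : y ^+ n * k <= n`!%:R * E.
  have -> : y ^+ n * k = y ^+ n * expR (- y) * expR (- (2^-1 * ln u)).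
    by rewrite /k /gkernel expRD mulrCA mulrC.
  apply: ler_pM; rewrite ?mulr_ge0 ?exprn_ge0 ?expR_ge0 ?exprn_expRN_le//.
  by rewrite ler_expR lerN2 ler_pM2l// ler_ln.
have k1 := yk 0%N; have k2 := yk 1%N; have k3 := yk 2%N.
rewrite expr0 mul1r in k1; rewrite expr1 in k2.
rewrite /= mul1r in k1; rewrite /= mul1r in k2; rewrite (_ : 2`! = 2)%N // in k3.
have B : 3 * k + 8 * (y * k) + 4 * (y ^+ 2 * k) <= 19 * E by lra.
have ww : w ^+ 2 <= V ^+ 2 by rewrite ler_pXn2r ?nnegrE// ltW.
split.
- rewrite /gkernel3 -/k -/w.
  have -> : 3 * x * w ^+ 2 - x ^+ 3 * w ^+ 3 = x * w ^+ 2 * (3 - 2 * y) by rewrite /y; field.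
  rewrite 3!normrM (gtr0_norm k0) (ger0_norm (sqr_ge0 w)).
  have x1 : `|x| <= 1 + x ^+ 2.
    by have := sqr_ge0 (`|x| - 1); rewrite sqrrB1 real_normK ?num_real//; have := sqr_ge0 x; lra.
  have n3 : `|3 - 2 * y| <= 3 + 2 * y by rewrite ler_norml; apply/andP; split; lra.
  have xw : `|x| * w ^+ 2 <= (V ^+ 2 + V) * (1 + 2 * y).
    apply: le_trans (_ : (1 + x ^+ 2) * w ^+ 2 <= _); first by rewrite ler_wpM2r// sqr_ge0.
    have -> : (1 + x ^+ 2) * w ^+ 2 = w ^+ 2 + w * (2 * y) by rewrite /y; field.
    have : w * (2 * y) <= V * (2 * y) by rewrite ler_wpM2r// mulr_ge0.
    have : 0 <= V ^+ 2 * (2 * y) by rewrite mulr_ge0 ?sqr_ge0// mulr_ge0.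
    by lra.
  apply: le_trans (_ : (V ^+ 2 + V) * (1 + 2 * y) * (3 + 2 * y) * k <= _).
    by rewrite ler_wpM2r ?(ltW k0)// ler_pM// mulr_ge0// sqr_ge0.
  rewrite [leLHS](_ : _ = (V ^+ 2 + V) * (3 * k + 8 * (y * k) + 4 * (y ^+ 2 * k))); last by ring.
  rewrite [leRHS](_ : _ = (V ^+ 2 + V) * (19 * E)); last by ring.
  by rewrite ler_wpM2l// addr_ge0 ?sqr_ge0// ltW.
- rewrite /gkernel22 -/k -/w.
  have -> : (2^-1 * x ^+ 2 * w ^+ 2 - 2^-1 * w) ^+ 2 + 2^-1 * w ^+ 2 - x ^+ 2 * w ^+ 3 =
      w ^+ 2 * (y ^+ 2 - 3 * y + 3 / 4) by rewrite /y; field.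
  rewrite 2!normrM (gtr0_norm k0) (ger0_norm (sqr_ge0 w)).
  have n3 : `|y ^+ 2 - 3 * y + 3 / 4| <= y ^+ 2 + 3 * y + 1.
    by rewrite ler_norml; have := sqr_ge0 y => ?; apply/andP; split; lra.
  apply: le_trans (_ : (V ^+ 2 + V) * (y ^+ 2 + 3 * y + 1) * k <= _).
    rewrite ler_wpM2r ?(ltW k0)// ler_pM ?sqr_ge0//.
    by rewrite (le_trans ww)// lerDl ltW.
  rewrite -[leLHS]mulrA [leRHS](_ : _ = (V ^+ 2 + V) * (19 * E)); last by ring.
  rewrite ler_wpM2l ?addr_ge0 ?sqr_ge0 ?(ltW V0)//.
  have : 0 <= y * k by rewrite mulr_ge0// ltW.
  have : 0 <= y ^+ 2 * k by rewrite mulr_ge0 ?sqr_ge0// ltW.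
  by lra.
Qed.

Definition gkernel_taylor_bound v C : Prop := forall u x, v <= u ->
  (forall y, `|gkernel u (x + y) - gkernel u x - y * gkernel1 u x - y ^+ 2 / 2 * gkernel2 u x|
     <= C * `|y| ^+ 3) /\
  (forall s, 0 <= s -> `|gkernel (u + s) x - gkernel u x - s / 2 * gkernel2 u x| <= C * s ^+ 2).

Lemma gkernel_taylor v : 0 < v -> exists2 C, 0 <= C & gkernel_taylor_bound v C.
Proof.
move=> v0; have [C C0 bound] := gkernel_derivatives_bounded v0; exists C => // u x vu.
have comp (f : R -> R) a y d t : is_derive (a + t * y) 1 f d ->
    is_derive t 1 (fun t => f (a + t * y)) (y * d).
  move=> df; rewrite mulrC; apply: (@is_derive1_comp _ f (fun t => a + t * y)) => //.
  by apply: is_derive_eq; rewrite /GRing.scale/=; ring.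
have compZ (f : R -> R) a y c d t : is_derive (a + t * y) 1 f d ->
    is_derive t 1 (fun t => c * f (a + t * y)) (c * (y * d)).
  move=> /comp df; apply: is_derive_eq; by rewrite /GRing.scale/=; ring.
have compZ' (f : R -> R) a y d t : is_derive (a + t * y) 1 f d ->
    is_derive t 1 (fun t => y * f (a + t * y)) (y * (y * d)) by exact: compZ.
have i01 : 0 <= (1 : R) <= 1 by rewrite ler01 lexx.
split=> [y|s s0].
- have := @taylor3_le R (fun t => gkernel u (x + t * y)) (fun t => y * gkernel1 u (x + t * y))
    (fun t => y * (y * gkernel2 u (x + t * y))) (fun t => y * (y * (y * gkernel3 u (x + t * y))))
    (C * `|y| ^+ 3) 1 i01.
  rewrite mul0r addr0 !mul1r expr1n.
  rewrite (_ : gkernel u _ - _ - _ - _ = gkernel u (x + y) - gkernel u x -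
    y * gkernel1 u x - y ^+ 2 / 2 * gkernel2 u x); last by ring.
  apply.
  + by move=> t _; apply: comp; exact: is_derive_gkernel.
  + by move=> t _; apply: compZ; exact: is_derive_gkernel1.
  + move=> t _; have := @compZ (gkernel2 u) x y (y * y) _ t (is_derive_gkernel2 u _).
    rewrite -!mulrA; congr (is_derive _ _ _ _); apply/funext => z; by rewrite mulrA.
  + move=> t _; rewrite 3!normrM [leRHS](_ : _ = `|y| * (`|y| * (`|y| * C))); last by ring.
    by do 3 (apply: ler_wpM2l => //); have [] := bound u (x + t * y) vu.
- rewrite -(mulrA s 2^-1).
  have := @taylor2_le R (fun t => gkernel (u + t * s) x) (fun t => s * (2^-1 * gkernel2 (u + t * s) x))
    (fun t => s * (s * gkernel22 (u + t * s) x)) (C * s ^+ 2) 1 i01.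
  rewrite mul0r addr0 !mul1r.
  apply.
  + move=> t /andP[t0 _]; have ut : 0 < u + t * s.
      by rewrite (lt_le_trans v0)// (le_trans vu)// lerDl mulr_ge0.
    exact: (comp (fun u => gkernel u x) u s _ t (is_derive_gkernel_variance x ut)).
  + move=> t /andP[t0 _]; have ut : 0 < u + t * s.
      by rewrite (lt_le_trans v0)// (le_trans vu)// lerDl mulr_ge0.
    exact: (compZ' (fun u => 2^-1 * gkernel2 u x) u s _ t (is_derive_gkernel2_variance x ut)).
  + move=> t /andP[t0 _]; rewrite 2!normrM (ger0_norm s0) [leRHS]mulrC expr2 -mulrA.
    do 2 (apply: ler_wpM2l => //).
    by have [] := bound (u + t * s) x; rewrite ?(le_trans vu)// lerDl mulr_ge0.
Qed.

End gaussian_kernel_taylor.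

(** * The central limit theorem for binomial laws *)

Section binomial_clt.
Context {R : realType} (T : finType) (p sigma : R).
Implicit Types (G : {set T}) (e : T) (r : seq T) (u v x : R).

Definition centred_step e G : R := if e \in G then (1 - p) / sigma else - (p / sigma).

Lemma sum_centred_step G :
  \sum_e centred_step e G = (#|G|%:R - #|T|%:R * p) / sigma.
Proof.
rewrite /centred_step (eq_bigr (fun e => ((e \in G)%:R - p) / sigma)); last first.
  by move=> e _; case: ifP => _; rewrite //= sub0r mulNr.
rewrite -mulr_suml sumrB sumr_const mulr_natl; congr ((_ - _ *+ _) / _).
by rewrite -sum1_card natr_sum [RHS]big_mkcond; apply: eq_bigr => e _; case: (e \in G).
Qed.

Hypotheses (p01 : 0 <= p <= 1) (sigma0 : 0 < sigma).
Hypothesis sigmaE : sigma ^+ 2 = #|T|%:R * p * (1 - p).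

Let m : R := #|T|%:R.

Let m0 : 0 < m.
Proof.
rewrite lt0r ler0n andbT; apply/eqP => mE; have := exprn_gt0 2 sigma0.
by rewrite sigmaE -/m mE !mul0r ltxx.
Qed.

(** Both increments have mean [0] and variance [1 / m], so only the Taylor
remainders differ; the Bernoulli increment is at most [1 / sigma], whence the
first error term. *)
Lemma gkernel_step v C : 0 < v -> 0 <= C -> gkernel_taylor_bound v C ->
  forall u x, v <= u ->
  `|p * gkernel u (x + (1 - p) / sigma) + (1 - p) * gkernel u (x - p / sigma)
    - gkernel (u + m^-1) x| <= C * ((sigma * m)^-1 + m ^- 2).
Proof.
move=> v0 C0 tay u x vu; have [ty ts] := tay u x vu.
have /andP[p0 p1] := p01; have q0 : 0 <= 1 - p by rewrite subr_ge0.
have := ty ((1 - p) / sigma); have := ty (- (p / sigma)).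
have := ts m^-1; rewrite invr_ge0 (ltW m0) => /(_ isT).
set a := (1 - p) / sigma; set b := p / sigma.
have a0 : 0 <= a by rewrite divr_ge0// ltW.
have b0 : 0 <= b by rewrite divr_ge0// ltW.
rewrite normrN (ger0_norm a0) (ger0_norm b0).
set g0 := gkernel u x; set ga := gkernel u (x + a); set gb := gkernel u (x - b).
set gm := gkernel _ x; set g1 := gkernel1 u x; set g2 := gkernel2 u x => hm hb ha.
have ab : p * a = (1 - p) * b by rewrite /a /b; ring.
have sm : p * (1 - p) = sigma ^+ 2 / m.
  by rewrite sigmaE -/m; field; exact: lt0r_neq0.
have ab2 : p * a ^+ 2 + (1 - p) * b ^+ 2 = m^-1.
  transitivity (p * (1 - p) / sigma ^+ 2); first by rewrite /a /b; field; exact: lt0r_neq0.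
  by rewrite sm; field; rewrite !lt0r_neq0.
have ab3 : p * a ^+ 3 + (1 - p) * b ^+ 3 <= (sigma * m)^-1.
  have -> : p * a ^+ 3 + (1 - p) * b ^+ 3 =
      (p * (1 - p) / sigma ^+ 2) * (((1 - p) ^+ 2 + p ^+ 2) / sigma).
    by rewrite /a /b; field; exact: lt0r_neq0.
  rewrite sm (_ : sigma ^+ 2 / m / sigma ^+ 2 = m^-1); last by field; rewrite !lt0r_neq0.
  rewrite invfM mulrC ler_wpM2r ?invr_ge0 ?(ltW m0)// ler_piMl ?invr_ge0 ?(ltW sigma0)//.
  have : 0 <= p * (1 - p) by rewrite mulr_ge0.
  by rewrite !expr2; lra.
have -> : p * ga + (1 - p) * gb - gm =
   p * (ga - g0 - a * g1 - a ^+ 2 / 2 * g2) +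
   (1 - p) * (gb - g0 - - b * g1 - (- b) ^+ 2 / 2 * g2) - (gm - g0 - m^-1 / 2 * g2).
  rewrite -ab2 sqrrN.
  have -> : p * (ga - g0 - a * g1 - a ^+ 2 / 2 * g2) =
     p * ga - p * g0 - (p * a) * g1 - p * a ^+ 2 / 2 * g2 by ring.
  by rewrite ab; ring.
apply: le_trans (ler_normB _ _) _; rewrite [leRHS]mulrDr; apply: lerD; last by rewrite -exprVn.
apply: le_trans (ler_normD _ _) _; rewrite !normrM (ger0_norm p0) (ger0_norm q0).
apply: le_trans (_ : C * (p * a ^+ 3 + (1 - p) * b ^+ 3) <= _); last by rewrite ler_wpM2l.
have := ler_wpM2l p0 ha; have := ler_wpM2l q0 hb; lra.
Qed.

(** The points of [r] are exchanged one at a time for Gaussian increments, each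
exchange costing one error of [gkernel_step]. *)
Lemma mean_gkernel_steps v C : 0 < v -> 0 <= C -> gkernel_taylor_bound v C ->
  forall r u x, uniq r -> v <= u ->
  `|mean p (fun G => gkernel u (x + \sum_(e <- r) centred_step e G)) -
    gkernel (u + (size r)%:R / m) x| <= (size r)%:R * (C * ((sigma * m)^-1 + m ^- 2)).
Proof.
move=> v0 C0 tay r u x.
elim: r u => [|e r IH] u /=.
  move=> _ _; rewrite !mul0r addr0 (_ : mean _ _ = gkernel u x) ?subrr ?normr0//.
  by rewrite -[RHS](mean_cst T p); apply: eq_mean => G; rewrite big_nil addr0.
move=> /andP[er ur] vu; set B := C * _.
have vu' : v <= u + m^-1 by rewrite (le_trans vu)// lerDl invr_ge0 ltW.
have -> : u + (size r).+1%:R / m = u + m^-1 + (size r)%:R / m by rewrite -natr1; ring.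
rewrite -natr1 mulrDl mul1r [_ + B]addrC.
pose S G : R := \sum_(e <- r) centred_step e G.
rewrite -(mean_resample p e) (_ : mean p _ = mean p (fun G =>
    p * gkernel u (x + S G + (1 - p) / sigma) + (1 - p) * gkernel u (x + S G - p / sigma))).
  rewrite -[X in `|X|](subrKA (mean p (fun G => gkernel (u + m^-1) (x + S G)))).
  apply: le_trans (ler_normD _ _) _; apply: lerD; last exact: IH.
  rewrite -meanB; apply: le_trans (ler_norm_mean p01 _) _.
  rewrite -[leRHS](mean_cst T p); apply: le_mean => // G.
  exact: gkernel_step C0 tay _ _ vu.
have stepU G i : i \in r -> centred_step i (e |: G)%SET = centred_step i G.
  by move=> ir; rewrite /centred_step !inE; case: eqVneq er => // <-; rewrite ir.
have stepD G i : i \in r -> centred_step i (G :\ e)%SET = centred_step i G.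
  by move=> ir; rewrite /centred_step !inE; case: eqVneq er => // <-; rewrite ir.
apply: eq_mean => G; rewrite /resample !big_cons.
rewrite [in X in p * X](eq_big_seq _ (fun i ir => stepU G i ir)).
rewrite [in X in (1 - p) * X](eq_big_seq _ (fun i ir => stepD G i ir)).
rewrite -/(S G) /centred_step !inE eqxx/=.
by congr (_ * gkernel _ _ + _ * gkernel _ _); ring.
Qed.

End binomial_clt.

(** The Gaussian increments of all the points add up to variance [1], which takes
the kernel of variance [v] to that of variance [v + 1]. *)
Lemma binomial_clt_gkernel (R : realType) (v : R) : 0 < v -> exists2 C, 0 <= C &
  forall (T : finType) (p sigma : R), 0 <= p <= 1 -> 1 <= sigma ->
  sigma ^+ 2 = #|T|%:R * p * (1 - p) -> forall a : R,
  `|mean p (fun G : {set T} => gkernel v ((#|G|%:R - #|T|%:R * p) / sigma - a)) -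
    gkernel (v + 1) a| <= C / sigma.
Proof.
move=> v0; have [C C0 tay] := gkernel_taylor v0; exists (2 * C) => [|T p sigma p01 s1 sE a].
  by rewrite mulr_ge0.
have s0 : 0 < sigma by exact: lt_le_trans s1.
have sm : sigma <= #|T|%:R.
  apply: le_trans (_ : sigma ^+ 2 <= _); first by rewrite expr2 ler_peMl// ltW.
  rewrite sE -mulrA ler_piMr//; case/andP: p01 => p0 p1.
  by rewrite mulr_ile1// ?subr_ge0// lerBlDr lerDl.
have m0 : 0 < #|T|%:R :> R by exact: lt_le_trans sm.
have := mean_gkernel_steps p01 s0 sE v0 C0 tay (- a) (index_enum_uniq T) (lexx v).
have -> : size (index_enum T) = #|T| by rewrite cardT enumT.
rewrite divff ?lt0r_neq0// (_ : gkernel _ (- a) = gkernel (v + 1) a); last first.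
  by rewrite /gkernel sqrrN.
rewrite (_ : mean _ _ = mean p (fun G : {set T} => gkernel v ((#|G|%:R - #|T|%:R * p) / sigma - a))); last first.
  by apply: eq_mean => G; rewrite sum_centred_step addrC.
move=> /le_trans; apply.
rewrite mulrCA [2 * C]mulrC -mulrA ler_wpM2l//.
have -> : #|T|%:R * ((sigma * #|T|%:R)^-1 + #|T|%:R ^- 2) = sigma^-1 + #|T|%:R^-1 :> R.
  by field; rewrite !lt0r_neq0.
have : (#|T|%:R : R)^-1 <= sigma^-1 by rewrite lef_pV2.
by lra.
Qed.

(** * Gaussian smoothing of test functions *)

Section gaussian_smoothing.
Context {R : realType}.
Local Notation mu := (@lebesgue_measure R).
Implicit Types (F : R -> R) (m s v x a eps K : R).

Let c0 : R := (Num.sqrt (pi *+ 2))^-1.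

Let c0_ge0 : 0 <= c0. Proof. by rewrite invr_ge0 sqrtr_ge0. Qed.

Lemma normal_pdf_gkernel v x a : 0 < v ->
  normal_pdf x (Num.sqrt v) a = c0 * gkernel v (x - a).
Proof.
move=> v0; have s0 : Num.sqrt v != 0 by rewrite gt_eqF// sqrtr_gt0.
rewrite normal_pdfE// /normal_peak /normal_fun sqr_sqrtr ?ltW//.
rewrite -mulrnAr sqrtrM ?ltW// invfM mulrAC mulrC /c0; congr (_ * _).
rewrite /gkernel expRD; congr (_ * _).
  rewrite expRN -powR12_sqrt ?ltW// /powR gt_eqF//.
congr expR; rewrite -[_ *+ 2]mulr_natl invfM -sqrrN opprB; ring.
Qed.

(** Half of the exponent absorbs the square; second moments at variance [v] are thus
controlled by the total mass at variance [2 v]. *)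
Lemma sqr_mul_gkernel_le v z : 0 < v -> z ^+ 2 * gkernel v z <= 8 * v * gkernel (2 * v) z.
Proof.
move=> v0; pose y := 2^-1 * z ^+ 2 / (2 * v).
have y0 : 0 <= y by apply: divr_ge0; apply: mulr_ge0 => //; [exact: sqr_ge0|exact: ltW].
pose E := expR (- (2^-1 * ln v)).
have E0 : 0 < E by exact: expR_gt0.
have -> : gkernel v z = E * (expR (- y) * expR (- y)).
  rewrite /gkernel expRD; congr (_ * _); rewrite -expRD; congr expR.
  by rewrite /y; field; exact: lt0r_neq0.
have l2 : E <= 2 * expR (- (2^-1 * ln (2 * v))).
  rewrite lnM ?posrE// mulrDr opprD expRD -/E mulrA ler_peMl ?(ltW E0)//.
  rewrite expRN ler_pdivlMr ?expR_gt0// mul1r -[leRHS](@lnK R 2) ?posrE//.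
  by rewrite ler_expR ler_piMl ?ln_ge0//; lra.
have -> : gkernel (2 * v) z = expR (- (2^-1 * ln (2 * v))) * expR (- y).
  by rewrite /gkernel expRD.
have -> : z ^+ 2 * (E * (expR (- y) * expR (- y))) = 4 * v * (y * expR (- y)) * (E * expR (- y)).
  by rewrite /y; field; exact: lt0r_neq0.
have ye : y * expR (- y) <= 1 by have := exprn_expRN_le 1 y0; rewrite expr1.
apply: le_trans (_ : 4 * v * 1 * (E * expR (- y)) <= _).
  by apply: ler_wpM2r; rewrite ?mulr_ge0 ?expR_ge0 ?(ltW E0)// ler_wpM2l// mulr_ge0// ltW.
rewrite mulr1 (_ : 8 * v * _ = 4 * v * (2 * expR (- (2^-1 * ln (2 * v))) * expR (- y))); last by ring.
by rewrite ler_wpM2l ?mulr_ge0 ?(ltW v0)// ler_wpM2r ?expR_ge0.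
Qed.

(** The derivative in the variance at [1] is bounded, and [gkernel_taylor] controls
the remainder. *)
Lemma gkernel_variance_lipschitz : exists2 C : R, 0 <= C &
  forall v x, 0 <= v <= 1 -> `|gkernel (v + 1) x - gkernel 1 x| <= C * v.
Proof.
have [C C0 tay] := @gkernel_taylor R 1 ltr01; exists (C + 2) => [|v x /andP[v0 v1]].
  by rewrite addr_ge0.
have [_ /(_ v v0)] := tay 1 x (lexx 1); rewrite (addrC 1 v).
have g2 : `|gkernel2 1 x| <= 4.
  pose y := 2^-1 * x ^+ 2.
  have y0 : 0 <= y by rewrite mulr_ge0// sqr_ge0.
  rewrite /gkernel2 /gkernel invr1 expr1n !mulr1 ln1 mulr0 oppr0 add0r -/y.
  rewrite normrM (gtr0_norm (expR_gt0 _)).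
  have n1 : `|x ^+ 2 - 1| <= 2 * y + 1.
    by have := sqr_ge0 x => ?; rewrite ler_norml /y; apply/andP; split; lra.
  apply: le_trans (ler_wpM2r (expR_ge0 _) n1) _; rewrite mulrDl mul1r -mulrA.
  have := exprn_expRN_le 1 y0; have := exprn_expRN_le 0 y0.
  by rewrite expr0 expr1 mul1r factS fact0 muln1; lra.
set g := gkernel2 1 x in g2 *; set d := _ - gkernel 1 x => hd.
have : `|d| <= C * v ^+ 2 + v / 2 * 4.
  rewrite -[d](subrK (v / 2 * g)); apply: le_trans (ler_normD _ _) _; apply: lerD => //.
  by rewrite normrM ger0_norm ?divr_ge0// ler_wpM2l// divr_ge0.
move=> /le_trans; apply; have : C * v ^+ 2 <= C * v by rewrite ler_wpM2l// expr2 ler_piMl.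
by lra.
Qed.

Lemma integrable_mul_pdf F M m s : s != 0 -> continuous F -> (forall a, `|F a| <= M) ->
  mu.-integrable setT (EFin \o (fun a => F a * normal_pdf m s a)).
Proof.
move=> s0 cF bF.
have mF : measurable_fun setT (fun a => F a * normal_pdf m s a).
  apply: measurable_funM; last exact: measurable_normal_pdf.
  exact: continuous_measurable_fun.
apply: (@le_integrable _ _ _ mu setT measurableT _ (EFin \o (fun a => M * normal_pdf m s a))).
- exact/measurable_EFinP.
- move=> a _; rewrite /= lee_fin !normrM ler_wpM2r// (le_trans (bF a))//; exact: ler_norm.
- under [X in _.-integrable _ X]funext do rewrite /= EFinM.
  by apply: integrableZl => //; exact: integrable_normal_pdf.
Qed.

Lemma Rintegral_normal_pdf m s : \int[mu]_a normal_pdf m s a = 1.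
Proof. by rewrite /Rintegral integral_normal_pdf. Qed.

(** Smoothing averages the modulus of continuity at [x] against a density of total
mass [1] and second moment at most [8 v]. *)
Lemma gaussian_smoothing_error F M K eps v x : continuous F -> (forall a, `|F a| <= M) ->
  0 < v -> 0 <= K -> (forall a, `|F a - F x| <= eps + K * (a - x) ^+ 2) ->
  `|\int[mu]_a (F a * normal_pdf x (Num.sqrt v) a) - F x| <= eps + 8 * K * v.
Proof.
move=> cF bF v0 K0 mod.
have s0 : Num.sqrt v != 0 by rewrite gt_eqF// sqrtr_gt0.
set f1 := fun a => F a * normal_pdf x (Num.sqrt v) a.
set f2 := fun a => F x * normal_pdf x (Num.sqrt v) a.
have i1 : mu.-integrable setT (EFin \o f1) by exact: integrable_mul_pdf bF.
have i2 : mu.-integrable setT (EFin \o f2).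
  by apply: (@integrable_mul_pdf (fun=> F x) M) => // ?; exact: cvg_cst.
have -> : \int[mu]_a f1 a - F x = \int[mu]_a (f1 a - f2 a).
  rewrite RintegralB// /f2 RintegralZl//; last exact: integrable_normal_pdf.
  by rewrite Rintegral_normal_pdf mulr1.
have i3 : mu.-integrable setT (EFin \o (fun a => f1 a - f2 a)).
  by under [X in _.-integrable _ X]funext do rewrite /= EFinB; exact: integrableB.
apply: le_trans (le_normr_Rintegral _ i3) _ => //.
pose s2 := Num.sqrt (2 * v).
set g1 := fun a => eps * normal_pdf x (Num.sqrt v) a.
set g2 := fun a => 8 * K * v * normal_pdf x s2 a.
have Zi c m s : mu.-integrable setT (EFin \o (fun a => c * normal_pdf m s a)).
  under [X in _.-integrable _ X]funext do rewrite /= EFinM.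
  by apply: integrableZl => //; exact: integrable_normal_pdf.
have ig1 : mu.-integrable setT (EFin \o g1) by exact: Zi.
have ig2 : mu.-integrable setT (EFin \o g2) by exact: Zi.
have -> : eps + 8 * K * v = \int[mu]_a (g1 a + g2 a).
  rewrite RintegralD// /g1 /g2 !RintegralZl ?Rintegral_normal_pdf ?mulr1//; exact: integrable_normal_pdf.
apply: le_Rintegral => //.
- have := integrable_norm i3; by [].
- by under [X in _.-integrable _ X]funext do rewrite /= EFinD; exact: integrableD.
- move=> a _; rewrite /f1 /f2 /g1 /g2 -mulrBl normrM (ger0_norm (normal_pdf_ge0 _ _ _)).
  apply: le_trans (ler_wpM2r (normal_pdf_ge0 _ _ _) (mod a)) _.
  rewrite mulrDl lerD2l -[leLHS]mulrA [leRHS](_ : _ = K * (8 * v * normal_pdf x s2 a)); last by ring.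
  rewrite ler_wpM2l// /s2 !normal_pdf_gkernel ?mulr_gt0//.
  have := sqr_mul_gkernel_le (x - a) v0; rewrite -sqrrN opprB => h.
  rewrite mulrCA [leRHS](_ : _ = c0 * (8 * v * gkernel (2 * v) (x - a))); last by ring.
  by rewrite ler_wpM2l.
Qed.

Definition gauss_mean F : R := \int[mu]_a (F a * normal_pdf 0 1 a).

(** The density is a Radon-Nikodym derivative of the normal law. *)
Lemma integral_normal_prob F M : continuous F -> (forall a, `|F a| <= M) ->
  (\int[normal_prob 0 1]_x (F x)%:E = (gauss_mean F)%:E)%E.
Proof.
move=> cF bF; have n0 : (1 : R) != 0 by exact: oner_neq0.
have mF : measurable_fun setT F by exact: continuous_measurable_fun.
rewrite /gauss_mean /Rintegral fineK; last first.
  by apply: integrable_fin_num => //; exact: integrable_mul_pdf bF.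
have dom := normal_prob_dominates (0 : R) 1.
rewrite -(Radon_Nikodym_change_of_variables dom)//=; last first.
  apply: measurable_bounded_integrable => //.
    by rewrite (le_lt_trans (probability_le1 _ _))// ltry.
  exists M; split; first exact: num_real.
  by move=> M' MM' a _; exact: le_trans (bF a) (ltW MM').
apply: ae_eq_integral => //.
- by apply: emeasurable_funM => //; exact/measurable_EFinP.
- by apply: (measurable_int mu); exact: (integrable_mul_pdf 0 n0 cF bF).
- apply: (@ae_eqe_mul2l _ _ _ mu setT _ (fun x => (normal_pdf 0 1 x)%:E) (EFin \o F)).
  rewrite Radon_NikodymE//=.
  case: cid => /= h [h1 h2 h3].
  apply: integral_ae_eq => //=.
  + by apply/measurable_EFinP; exact: measurable_normal_pdf.
  + by move=> E E01 mE; rewrite -h3.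
Qed.

End gaussian_smoothing.

Section test_functions.
Context {R : realType}.
Local Notation mu := (@lebesgue_measure R).
Implicit Types (F : R -> R) (A M eps : R).

Let c0 : R := (Num.sqrt (pi *+ 2))^-1.

Let c0_ge0 : 0 <= c0. Proof. by rewrite invr_ge0 sqrtr_ge0. Qed.

(** Uniform continuity and boundedness in a single quadratic estimate, suited to
taking expectations. *)
Lemma quadratic_modulus F A M eps : continuous F -> (forall a, A < `|a| -> F a = 0) ->
  (forall a, `|F a| <= M) -> 0 < eps ->
  exists2 K, 0 <= K & forall x y, `|F x - F y| <= eps + K * (x - y) ^+ 2.
Proof.
move=> cF sF bF e0.
have M0 : 0 <= M by exact: le_trans (bF 0).
have cpt : compact `[- A, A]%classic by exact: segment_compact.
have /(_ _ (0^'+) (fun d x => forall y, `|x - y| < d -> `|F x - F y| <= eps))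
  := (compact_near_coveringP _).1 cpt.
case=> [x _|d d0 dP].
  have /cvgrPdist_lt/(_ _ (divr_gt0 e0 (ltr0n _ 2))) := cF x.
  move=> /nbhs_ballP[r /= r0 rP].
  have r2 : 0 < r / 2 by rewrite divr_gt0.
  exists (ball x (r / 2), [set d | d < r / 2]); first split => /=.
  - exact: nbhsx_ballx.
  - exact: nbhs_right_lt.
  move=> [z d] [/= xz dr] y zy.
  have -> : F z - F y = (F x - F y) - (F x - F z) by ring.
  apply: le_trans (ler_normB _ _) _; rewrite [eps]splitr; apply: lerD; apply: ltW; apply: rP.
    rewrite /ball/= (_ : x - y = (x - z) + (z - y)); last by ring.
    rewrite (le_lt_trans (ler_normD _ _))// [r]splitr ltrD//.
    exact: lt_trans dr.
  by apply: lt_trans xz _; rewrite ltr_pdivrMr// mulr2n mulrDr mulr1 ltrDl.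

pose e := d / 2; have e00 : 0 < e by rewrite divr_gt0.
have unif x y : `|x| <= A -> `|x - y| < e -> `|F x - F y| <= eps.
  move=> xA; apply: (dP e) => //=; last by rewrite in_itv/= -ler_norml.
  by rewrite sub0r normrN gtr0_norm// ltr_pdivrMr// mulr2n mulrDr mulr1 ltrDl.
have Q0 : 0 <= 2 * M / e ^+ 2.
  by apply: divr_ge0; [exact: mulr_ge0|apply: exprn_ge0; exact: ltW].
exists (2 * M / e ^+ 2) => [//|x y].
have q0 : 0 <= 2 * M / e ^+ 2 * (x - y) ^+ 2 by rewrite mulr_ge0// sqr_ge0.
have [exy|xye] := leP e `|x - y|.
  apply: le_trans (ler_normB _ _) _; apply: le_trans (lerD (bF x) (bF y)) _.
  apply: ler_wpDl; first exact: ltW.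
  apply: le_trans (_ : 2 * M / e ^+ 2 * e ^+ 2 <= _).
    by rewrite divfK ?gt_eqF ?exprn_gt0//; lra.
  rewrite ler_wpM2l// -[leRHS]real_normK ?num_real//.
  by rewrite ler_pXn2r ?nnegrE// ltW.
apply: ler_wpDr => //; have [xA|Ax] := leP `|x| A; first exact: unif.
have [yA|Ay] := leP `|y| A; first by rewrite distrC unif// distrC.
by rewrite !sF// subr0 normr0 ltW.
Qed.

Lemma compact_support_integrable F A M : continuous F -> (forall a, A < `|a| -> F a = 0) ->
  (forall a, `|F a| <= M) -> mu.-integrable setT (EFin \o F).
Proof.
move=> cF sF bF; rewrite (_ : EFin \o F = (EFin \o F) \_ `[- A, A]%classic); last first.
  apply/funext => a; rewrite patchE; case: ifPn => //.
  rewrite notin_setE/= in_itv/= -ler_norml => /negP; rewrite -ltNge => /sF ->.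
  by [].
have iD : mu.-integrable `[- A, A]%classic (EFin \o F).
  apply: measurable_bounded_integrable => //=.
  - by rewrite lebesgue_measure_itv/=; case: ifPn => _; rewrite ?ltry// -EFinD ltry.
  - by apply: measurable_funTS; exact: continuous_measurable_fun.
  - exists M; split; first exact: num_real.
    by move=> M' MM' a _; exact: le_trans (bF a) (ltW MM').
by move/integrable_mkcond : iD; apply.
Qed.

Lemma Rintegral_sum (I : Type) (r : seq I) (f : I -> R -> R) :
  (forall i, mu.-integrable setT (EFin \o f i)) ->
  mu.-integrable setT (EFin \o (fun a => \sum_(i <- r) f i a)) /\
  \int[mu]_a (\sum_(i <- r) f i a) = \sum_(i <- r) \int[mu]_a f i a.
Proof.
move=> fi; elim: r => [|i r [IH1 IH2]].
  rewrite big_nil; under [X in _.-integrable _ (EFin \o X)]funext do rewrite big_nil.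
  split; first exact: integrable0.
  under eq_Rintegral do rewrite big_nil; by rewrite Rintegral_cst// mul0r.
rewrite big_cons -IH2; under [X in _.-integrable _ (EFin \o X)]funext do rewrite big_cons.
split; last by under eq_Rintegral do rewrite big_cons; rewrite RintegralD.
under [X in _.-integrable _ X]funext do rewrite /= EFinD.
exact: (integrableD measurableT (fi i) IH1).
Qed.

(** A smoothed test function is a mixture of Gaussian kernels, so closeness of a
finite law to the normal law on all kernels of one small variance [v], uniformly
in the centre, carries over to it. The price of smoothing is paid twice: the
function moves by little, and the normal law is replaced by that of variance
[v + 1]. *)
Lemma gaussian_test_approx F A M eps : continuous F -> (forall a, A < `|a| -> F a = 0) ->
  (forall a, `|F a| <= M) -> 0 < eps ->
  exists v L : R, [/\ 0 < v, 0 <= L & forall (I : finType) (w y : I -> R) (delta : R),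
    (forall i, 0 <= w i) -> \sum_i w i = 1 ->
    (forall a, `|\sum_i w i * gkernel v (y i - a) - gkernel (v + 1) a| <= delta) ->
    `|\sum_i w i * F (y i) - gauss_mean F| <= eps + L * delta].
Proof.
move=> cF sF bF e0; have e20 : 0 < eps / 2 by rewrite divr_gt0.
have [K K0 mod] := quadratic_modulus cF sF bF e20.
have iF := compact_support_integrable cF sF bF.
have [C C0 lip] := @gkernel_variance_lipschitz R.
pose J := \int[mu]_a `|F a|; have J0 : 0 <= J by exact: Rintegral_ge0.
(* [D v] bounds the total cost of smoothing: that of moving the function, and that
of changing the variance of the normal law. *)
pose D := 8 * K + c0 * J * C + 1.
have D0 : 0 < D by rewrite ltr_wpDl// addr_ge0 ?mulr_ge0.
pose v := Num.min 1 (eps / 2 / D).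
have v0 : 0 < v by rewrite lt_min ltr01 divr_gt0.
have vD : v * D <= eps / 2 by rewrite -ler_pdivlMr// ge_min lexx orbT.
have v01 : 0 <= v <= 1 by rewrite ltW//= ge_min lexx.
exists v, (c0 * J); split => //; first exact: mulr_ge0.
move=> I w y delta w0 w1 close.
pose Fv x := \int[mu]_a (F a * normal_pdf x (Num.sqrt v) a).
have s0 : Num.sqrt v != 0 by rewrite gt_eqF// sqrtr_gt0.
have step1 : `|\sum_i w i * F (y i) - \sum_i w i * Fv (y i)| <= eps / 2 + 8 * K * v.
  rewrite -sumrB; apply: le_trans (ler_norm_sum _ _ _) _.
  have -> : eps / 2 + 8 * K * v = \sum_i w i * (eps / 2 + 8 * K * v).
    by rewrite -mulr_suml w1 mul1r.
  apply: ler_sum => i _.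
  rewrite -mulrBr normrM (ger0_norm (w0 i)) ler_wpM2l// distrC.
  exact: (gaussian_smoothing_error cF bF v0 K0 (fun a => mod a (y i))).
pose h a := \sum_i w i * normal_pdf (y i) (Num.sqrt v) a.
pose f i a := w i * (F a * normal_pdf (y i) (Num.sqrt v) a).
have fi i : mu.-integrable setT (EFin \o f i).
  under [X in _.-integrable _ X]funext do rewrite /= /f EFinM.
  by apply: integrableZl => //; exact: (integrable_mul_pdf _ s0 cF bF).
have [ih Eh] := Rintegral_sum (index_enum I) fi.
have fh a : \sum_i f i a = F a * h a.
  by rewrite /h mulr_sumr; apply: eq_bigr => i _; rewrite /f mulrCA.
have step2 : \sum_i w i * Fv (y i) = \int[mu]_a (F a * h a).
  under [RHS]eq_Rintegral do rewrite -fh.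
  rewrite Eh; apply: eq_bigr => i _; rewrite /f RintegralZl//.
  exact: (integrable_mul_pdf _ s0 cF bF).
have ih' : mu.-integrable setT (EFin \o (fun a => F a * h a)).
  by move: ih; congr (_.-integrable _ _); apply/funext => a /=; rewrite fh.
have i1 : mu.-integrable setT (EFin \o (fun a => F a * normal_pdf 0 1 a)).
  by apply: (integrable_mul_pdf _ _ cF bF); exact: oner_neq0.
have step3 : `|\int[mu]_a (F a * h a) - gauss_mean F| <= J * (c0 * (delta + C * v)).
  rewrite /gauss_mean -RintegralB//.
  have i3 : mu.-integrable setT (EFin \o (fun a => F a * h a - F a * normal_pdf 0 1 a)).
    by under [X in _.-integrable _ X]funext do rewrite /= EFinB; exact: integrableB.
  apply: le_trans (le_normr_Rintegral _ i3) _ => //.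
  have iaF : mu.-integrable setT (EFin \o (fun a => `|F a|)) by have := integrable_norm iF.
  rewrite -RintegralZr//; apply: le_Rintegral => //.
  - by have := integrable_norm i3.
  - under [X in _.-integrable _ X]funext do rewrite /= EFinM.
    exact: integrableZr.
  - move=> a _; rewrite -mulrBr normrM ler_wpM2l//.
    have -> : h a - normal_pdf 0 1 a =
        c0 * ((\sum_i w i * gkernel v (y i - a) - gkernel (v + 1) a) + (gkernel (v + 1) a - gkernel 1 a)).
      rewrite addrA subrK mulrBr mulr_sumr -[in normal_pdf 0 1]sqrtr1 normal_pdf_gkernel//.
      congr (_ - _); last by rewrite /gkernel sub0r sqrrN.
      by apply: eq_bigr => i _; rewrite normal_pdf_gkernel// mulrCA.
    rewrite normrM (ger0_norm c0_ge0) ler_wpM2l//.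
    by apply: le_trans (ler_normD _ _) _; apply: lerD => //; exact: lip.
rewrite -[X in `|X|](subrKA (\sum_i w i * Fv (y i))).
apply: le_trans (ler_normD _ _) _; rewrite {2}step2.
apply: le_trans (lerD step1 step3) _; move: vD; rewrite /D => vD.
have -> : eps / 2 + 8 * K * v + J * (c0 * (delta + C * v)) =
  eps / 2 + (v * (8 * K + c0 * J * C)) + c0 * J * delta by ring.
rewrite lerD2r [leRHS]splitr lerD2l (le_trans _ vD)// ler_wpM2l ?(ltW v0)//.
by rewrite lerDl.
Qed.

End test_functions.

(** * Standardization and truncation *)

Section standardization.
Context {R : realType} (T : finType) (p : R).
Hypothesis p01 : 0 <= p <= 1.
Implicit Types X Y : {set T} -> R.

(** Let [x] and [y] be [X] and [c * Y] after centring, with standard deviations [t]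
and [s]. Then [E (s x - t y)^2 = s t (E (x - y)^2 - (t - s)^2)], so the
standardizations differ in mean square by at most [E (x - y)^2 / (s t)]; and
[s <= 2 t], as [E (x - y)^2] is at most [s^2 / 4]. *)
Lemma standardized_close X Y (c theta : R) : 0 < c -> 0 < variance p Y -> theta <= 4^-1 ->
  variance p (fun G => X G - c * Y G) <= theta * (c ^+ 2 * variance p Y) ->
  mean p (fun G => ((X G - mean p X) / Num.sqrt (variance p X) -
                    (Y G - mean p Y) / Num.sqrt (variance p Y)) ^+ 2) <= 2 * theta.
Proof.
move=> c0 vY th; set v := variance p (fun G => X G - c * Y G) => vle.
set sY := Num.sqrt (variance p Y); set t := Num.sqrt (variance p X).
have sY0 : 0 < sY by rewrite sqrtr_gt0.
pose s := c * sY; have s0 : 0 < s by exact: mulr_gt0.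
have s2 : s ^+ 2 = c ^+ 2 * variance p Y by rewrite exprMn sqr_sqrtr// ltW.
have t2 : t ^+ 2 = variance p X by rewrite sqr_sqrtr// variance_ge0.
rewrite -s2 in vle.
pose x G := X G - mean p X; pose y G := c * (Y G - mean p Y).
have vE : v = mean p (fun G => (x G - y G) ^+ 2).
  rewrite /v /variance meanB meanZ; apply: eq_mean => G; rewrite /x /y; ring.
have yE : mean p (fun G => y G ^+ 2) = s ^+ 2.
  by rewrite s2 -meanZ; apply: eq_mean => G; rewrite exprMn.
have xE : mean p (fun G => x G ^+ 2) = t ^+ 2 by rewrite t2.
pose xy := mean p (fun G => x G * y G).
have vxy : v = t ^+ 2 + s ^+ 2 - 2 * xy.
  rewrite vE -xE -yE -meanZ -meanD -meanB; apply: eq_mean => G; ring.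
have ts : s ^+ 2 <= 2 * t ^+ 2 + 2 * v.
  rewrite -yE -xE vE -!meanZ -meanD; apply: le_mean => // G.
  by have := sqr_ge0 (2 * x G - y G); lra.
have th0 : v <= 4^-1 * s ^+ 2.
  by apply: (le_trans vle); rewrite ler_wpM2r// sqr_ge0.
have th0' : 0 <= theta.
  by rewrite -(pmulr_lge0 _ (exprn_gt0 2 s0)) (le_trans _ vle)// variance_ge0.
have t0 : 0 <= t by exact: sqrtr_ge0.
have ts2 : s <= 2 * t.
  have : s ^+ 2 <= (2 * t) ^+ 2 by rewrite (_ : (2 * t) ^+ 2 = 4 * t ^+ 2); [lra|ring].
  by rewrite ler_pXn2r// nnegrE ?mulr_ge0// ltW.
have tp : 0 < t by have := lt_le_trans s0 ts2; rewrite pmulr_rgt0.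
have -> : mean p (fun G => ((X G - mean p X) / t - (Y G - mean p Y) / sY) ^+ 2) =
    (s * t)^-1 ^+ 2 * mean p (fun G => (s * x G - t * y G) ^+ 2).
  rewrite -meanZ; apply: eq_mean => G; rewrite /x /y /s; field.
  by rewrite !lt0r_neq0.
have -> : mean p (fun G => (s * x G - t * y G) ^+ 2) = s * t * (v - (t - s) ^+ 2).
  transitivity (s ^+ 2 * t ^+ 2 + t ^+ 2 * s ^+ 2 - 2 * s * t * xy).
    rewrite -[X in s ^+ 2 * X]xE -[X in t ^+ 2 * X]yE /xy -!meanZ -meanD -meanB; apply: eq_mean => G; ring.
  rewrite vxy; ring.
apply: le_trans (_ : (s * t)^-1 * v <= _).
  rewrite [leLHS](_ : _ = (s * t)^-1 * (v - (t - s) ^+ 2)); last by field; rewrite !lt0r_neq0.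
  apply: ler_wpM2l; first by rewrite invr_ge0 mulr_ge0// ltW.
  by rewrite lerBlDr lerDl sqr_ge0.
rewrite mulrC ler_pdivrMr ?mulr_gt0//; apply: (le_trans vle).
rewrite [leRHS](_ : _ = theta * s * (2 * t)); last by ring.
by rewrite expr2 mulrA ler_wpM2l// mulr_ge0// ltW.
Qed.

End standardization.

Section truncation.
Context {R : realType}.
Local Notation mu := (@lebesgue_measure R).
Implicit Types (f : R -> R) (A M eps : R).

(** The positive part of [1 - x^2 / A^2], in a form whose continuity is immediate. *)
Definition cutoff A (x : R) : R := 2^-1 * (1 - x ^+ 2 / A ^+ 2 + `|1 - x ^+ 2 / A ^+ 2|).

Lemma cutoff_ge0 A x : 0 <= cutoff A x.
Proof.
rewrite mulr_ge0//; set a := 1 - _.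
by have := ler_norm (- a); rewrite normrN; lra.
Qed.

Lemma cutoff_le1 A x : cutoff A x <= 1.
Proof.
have : 0 <= x ^+ 2 / A ^+ 2 by rewrite divr_ge0 ?sqr_ge0.
by rewrite /cutoff; case: (ger0P (1 - x ^+ 2 / A ^+ 2)); lra.
Qed.

Lemma cutoff_near1 A x : 1 - cutoff A x <= (A ^+ 2)^-1 * x ^+ 2.
Proof.
rewrite mulrC; have : 0 <= x ^+ 2 / A ^+ 2 by rewrite divr_ge0 ?sqr_ge0.
by rewrite /cutoff; case: (ger0P (1 - x ^+ 2 / A ^+ 2)); lra.
Qed.

Lemma cutoff_support A x : 0 < A -> A < `|x| -> cutoff A x = 0.
Proof.
move=> A0 Ax; rewrite /cutoff ler0_norm ?subrr ?mulr0// subr_le0.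
rewrite ler_pdivlMr ?exprn_gt0// mul1r -[leRHS]real_normK ?num_real//.
by rewrite ler_pXn2r ?nnegrE// ltW.
Qed.

Lemma continuous_cutoff A : continuous (cutoff A).
Proof.
have c : continuous (fun x : R => 1 - x ^+ 2 / A ^+ 2).
  move=> x; apply: cvgB; first exact: cvg_cst.
  by apply: cvgM; [exact: exprn_continuous|exact: cvg_cst].
move=> x; apply: cvgM; first exact: cvg_cst.
by apply: cvgD; [exact: c|apply: cvg_norm; exact: c].
Qed.

(** The cutoff function is [1] at the origin and falls off quadratically, so the loss
is its smoothing error at the origin for variance [1]. *)
Lemma gauss_mean_cutoff A : 1 - gauss_mean (cutoff A) <= 8 * (A ^+ 2)^-1.
Proof.
have b a : `|cutoff A a| <= 1 by rewrite ger0_norm ?cutoff_ge0// cutoff_le1.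
have c0 : cutoff A 0 = 1 by rewrite /cutoff expr0n/= mul0r subr0 normr1; lra.
have K0 : 0 <= (A ^+ 2)^-1 by rewrite invr_ge0 sqr_ge0.
have mod a : `|cutoff A a - cutoff A 0| <= 0 + (A ^+ 2)^-1 * (a - 0) ^+ 2.
  by rewrite c0 subr0 add0r distrC ger0_norm ?subr_ge0 ?cutoff_le1// cutoff_near1.
have := gaussian_smoothing_error (@continuous_cutoff A) b ltr01 K0 mod.
rewrite c0 sqrtr1 -/(gauss_mean _) add0r mulr1 distrC => h.
exact: le_trans (ler_norm _) h.
Qed.

Lemma gauss_mean_truncation f M A : continuous f -> (forall a, `|f a| <= M) -> 0 < A ->
  `|gauss_mean f - gauss_mean (fun x => f x * cutoff A x)| <= M * (8 * (A ^+ 2)^-1).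
Proof.
move=> cf bf A0; have M0 : 0 <= M by exact: le_trans (bf 0).
have n0 : (1 : R) != 0 by exact: oner_neq0.
have cc := @continuous_cutoff A.
have cfc : continuous (fun x => f x * cutoff A x) by move=> x; apply: cvgM; [exact: cf|exact: cc].
have b a : `|cutoff A a| <= 1 by rewrite ger0_norm ?cutoff_ge0// cutoff_le1.
have bfc a : `|f a * cutoff A a| <= M by rewrite normrM -[M]mulr1 ler_pM.
have i1 := integrable_mul_pdf 0 n0 cf bf.
have i2 := integrable_mul_pdf 0 n0 cfc bfc.
have i3 := integrable_mul_pdf 0 n0 cc b.
have c1 : continuous (fun _ : R => M) by move=> x; exact: cvg_cst.
have i4 : mu.-integrable setT (EFin \o (fun a => M * normal_pdf 0 1 a)).
  by apply: (@integrable_mul_pdf _ (fun=> M) M) => // a; rewrite ger0_norm.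
have i5 : mu.-integrable setT (EFin \o (fun a => M * (cutoff A a * normal_pdf 0 1 a))).
  by under [X in _.-integrable _ X]funext do rewrite /= EFinM; exact: integrableZl.
rewrite /gauss_mean -RintegralB//.
have i6 : mu.-integrable setT (EFin \o (fun a => f a * normal_pdf 0 1 a - f a * cutoff A a * normal_pdf 0 1 a)).
  by under [X in _.-integrable _ X]funext do rewrite /= EFinB; exact: integrableB.
apply: le_trans (le_normr_Rintegral _ i6) _ => //.
apply: le_trans (_ : \int[mu]_a (M * normal_pdf 0 1 a - M * (cutoff A a * normal_pdf 0 1 a)) <= _).
  apply: le_Rintegral => //.
  - by have := integrable_norm i6.
  - by under [X in _.-integrable _ X]funext do rewrite /= EFinB; exact: integrableB.
  move=> a _; rewrite -mulrBl -mulrBr -[leRHS](_ : M * (1 - cutoff A a) * normal_pdf 0 1 a = _); last by ring.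
  rewrite normrM (ger0_norm (normal_pdf_ge0 _ _ _)) ler_wpM2r ?normal_pdf_ge0//.
  have -> : f a - f a * cutoff A a = f a * (1 - cutoff A a) by ring.
  by rewrite normrM (@ger0_norm _ (1 - _)) ?subr_ge0 ?cutoff_le1// ler_wpM2r// subr_ge0 cutoff_le1.
rewrite RintegralB// !RintegralZl//; last exact: integrable_normal_pdf.
by rewrite Rintegral_normal_pdf -mulrBr ler_wpM2l// gauss_mean_cutoff.
Qed.

(** Convergence against a single cutoff function shows that the approximating laws
put no more mass far out than the normal law does. *)
Lemma bounded_test_functions (T : nat -> finType) (q : nat -> R) (Z : forall n, {set T n} -> R) :
  (forall n, 0 <= q n <= 1) ->
  (forall F A M, continuous F -> (forall a, A < `|a| -> F a = 0) -> (forall a, `|F a| <= M) ->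
    forall eps, 0 < eps ->
    \forall n \near \oo, `|mean (q n) (fun G => F (Z n G)) - gauss_mean F| <= eps) ->
  forall f M, continuous f -> (forall a, `|f a| <= M) -> forall eps, 0 < eps ->
    \forall n \near \oo, `|mean (q n) (fun G => f (Z n G)) - gauss_mean f| <= eps.
Proof.
move=> q01 cpt f M cf bf eps e0; have M0 : 0 <= M by exact: le_trans (bf 0).
(* The cutoff loses at most [8 / A^2] of the normal mass, hence [eps / 8] of the
integral of [f]. *)
pose A := 1 + 64 * M / eps.
have A1 : 1 <= A by rewrite lerDl divr_ge0 ?mulr_ge0// ltW.
have A0 : 0 < A by exact: lt_le_trans A1.
have MA : M * (8 * (A ^+ 2)^-1) <= eps / 8.
  rewrite mulrA ler_pdivrMr ?exprn_gt0//.
  apply: le_trans (_ : eps / 8 * A <= _); last first.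
    by rewrite ler_wpM2l ?divr_ge0 ?(ltW e0)// expr2 ler_peMl// ltW.
  rewrite /A [leRHS]mulrDr (_ : eps / 8 * (64 * M / eps) = M * 8); last by field; exact: lt0r_neq0.
  by rewrite lerDr mulr1 divr_ge0// ltW.
have cc := @continuous_cutoff A.
have cfc : continuous (fun x => f x * cutoff A x) by move=> x; apply: cvgM; [exact: cf|exact: cc].
have b a : `|cutoff A a| <= 1 by rewrite ger0_norm ?cutoff_ge0// cutoff_le1.
have bfc a : `|f a * cutoff A a| <= M by rewrite normrM -[M]mulr1 ler_pM.
have s1 a : A < `|a| -> cutoff A a = 0 by exact: cutoff_support.
have s2 a : A < `|a| -> f a * cutoff A a = 0 by move=> /s1 ->; rewrite mulr0.
pose d := eps / (4 * (M + 1)); have M1 : 0 < M + 1 by rewrite ltr_wpDl.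
have d0 : 0 < d by rewrite divr_gt0// mulr_gt0.
have e40 : 0 < eps / 4 by rewrite divr_gt0.
have n1 := cpt _ _ _ cc s1 b _ d0; have n2 := cpt _ _ _ cfc s2 bfc _ e40.
near=> n.
have h1 : `|mean (q n) (fun G => cutoff A (Z n G)) - gauss_mean (cutoff A)| <= d by near: n.
have h2 : `|mean (q n) (fun G => f (Z n G) * cutoff A (Z n G)) -
  gauss_mean (fun x => f x * cutoff A x)| <= eps / 4 by near: n.
have h3 := gauss_mean_truncation cf bf A0.
have h4 : `|mean (q n) (fun G => f (Z n G)) - mean (q n) (fun G => f (Z n G) * cutoff A (Z n G))|
    <= M * (1 - mean (q n) (fun G => cutoff A (Z n G))).
  rewrite -meanB -[X in M * (X - _)](mean_cst (T n) (q n)) -meanB -meanZ.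
  apply: le_trans (ler_norm_mean (q01 n) _) _; apply: le_mean => // G.
  have -> : f (Z n G) - f (Z n G) * cutoff A (Z n G) = f (Z n G) * (1 - cutoff A (Z n G)) by ring.
  by rewrite normrM (@ger0_norm _ (1 - _)) ?subr_ge0 ?cutoff_le1// ler_wpM2r// subr_ge0 cutoff_le1.
have Md : M * d <= eps / 4.
  rewrite /d mulrA ler_pdivrMr ?mulr_gt0// (_ : eps / 4 * _ = (M + 1) * eps); last by field.
  by rewrite ler_wpM2r ?(ltW e0)// lerDl.
have h5 : M * (1 - mean (q n) (fun G => cutoff A (Z n G))) <= eps / 8 + eps / 4.
  apply: le_trans (_ : M * (8 * (A ^+ 2)^-1 + d) <= _); last by rewrite mulrDr lerD.
  rewrite ler_wpM2l//; have := gauss_mean_cutoff A.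
  by move: h1; rewrite ler_norml => /andP[h1 _]; lra.
move: h2 h3 h4; rewrite !ler_norml => /andP[? ?] /andP[? ?] /andP[? ?].
by apply/andP; split; lra.
Unshelve. all: by end_near.
Qed.

End truncation.

(** * The law of the random graph and the regime of the edge probability *)

Section gnp_mean.
Context {R : realType} (n : nat) (p : R).
Hypothesis p01 : 0 <= p <= 1.
Local Open Scope ereal_scope.

Lemma gnp_set1 (G : graph n) : gnp n p [set G] = (weight p G)%:E.
Proof.
rewrite /gnp p01 (bigD1 G)//= diracE mem_set// mule1 big1 ?adde0// => H HG.
by rewrite diracE memNset ?mule0//= => HG'; rewrite HG' eqxx in HG.
Qed.

Lemma integral_gnp (F : graph n -> R) :
  \int[gnp n p]_G (F G)%:E = (mean p F)%:E.
Proof.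
have FE G : (F G)%:E = \sum_(H : graph n) (F H)%:E * (\1_[set H] G)%:E.
  rewrite (bigD1 G)//= indicE mem_set// mule1 big1 ?adde0// => H HG.
  by rewrite indicE memNset ?mule0//= => HG'; rewrite HG' eqxx in HG.
under eq_integral do rewrite FE.
have i1 (H : graph n) : (gnp n p).-integrable setT (fun G => (\1_[set H] G)%:E).
  exact: integrable_indic.
rewrite integral_sum//; last by move=> H; exact: integrableZl.
rewrite /mean -sumEFin; apply: eq_bigr => H _.
by rewrite integralZl// integral_indic// setIT [X in _ * X]gnp_set1 -EFinM mulrC.
Qed.

Lemma expectation_gnp (F : graph n -> R) : 'E_(gnp n p)[F] = (mean p F)%:E.
Proof. by rewrite unlock integral_gnp. Qed.

Lemma variance_gnp (F : graph n -> R) : 'V_(gnp n p)[F] = (variance p F)%:E.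
Proof.
rewrite /random_variable.variance unlock expectation_gnp expectation_gnp/=.
by congr EFin; apply: eq_mean => G; rewrite /= expr2.
Qed.

End gnp_mean.

Section asymptotics.
Context {R : realType} (k : nat) (p : nat -> R).

Lemma little_omega_degree : (0 < k)%N ->
  little_omega p (fun n => n%:R `^ (- k%:R^-1)) ->
  forall B, \forall n \near \oo, B <= n%:R * p n ^+ k.
Proof.
move=> k0 hp B; pose K := Num.max 1 B.
have K1 : 1 <= K by rewrite le_max lexx.
have BK : B <= K by rewrite le_max lexx orbT.
have K0 : 0 < K by exact: lt_le_trans K1.
have h := hp _ K0; near=> n.
have n0 : (0 < n)%N by near: n; exact: nbhs_infty_gt.
have hn : K * n%:R `^ (- k%:R^-1) <= p n by near: n.
apply: (le_trans BK); apply: le_trans (_ : K ^+ k <= _).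
  by rewrite -[leLHS]expr1 ler_weXn2l.
have e : n%:R * (n%:R `^ (- k%:R^-1)) ^+ k = 1 :> R.
  rewrite -powR_mulrn ?powR_ge0// -powRrM mulNr mulVf ?pnatr_eq0 -?lt0n//.
  by rewrite powR_inv1// mulfV// pnatr_eq0 -lt0n.
have -> : K ^+ k = n%:R * (K * n%:R `^ (- k%:R^-1)) ^+ k by rewrite exprMn mulrCA e mulr1.
have w0 : 0 <= K * n%:R `^ (- k%:R^-1) := mulr_ge0 (ltW K0) (powR_ge0 _ _).
apply: (ler_wpM2l (ler0n _ _)).
by rewrite ler_pXn2r// nnegrE// (le_trans w0).
Unshelve. all: by end_near.
Qed.

Lemma little_o_degree :
  p =o_\oo (fun n => n%:R `^ (- k.+1%:R^-1)) -> (forall n, 0 <= p n) ->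
  forall eps : R, 0 < eps -> \forall n \near \oo, n%:R * p n ^+ k.+1 <= eps.
Proof.
move=> /eqoP hp p0 eps e0; pose d := Num.min 1 eps.
have d0 : 0 < d by rewrite lt_min ltr01.
have h := hp _ d0; near=> n.
have n0 : (0 < n)%N by near: n; exact: nbhs_infty_gt.
have : `|p n| <= d * `|n%:R `^ (- k.+1%:R^-1)| by near: n.
rewrite ger0_norm// ger0_norm ?powR_ge0// => hn.
have e : n%:R * (n%:R `^ (- k.+1%:R^-1)) ^+ k.+1 = 1 :> R.
  rewrite -powR_mulrn ?powR_ge0// -powRrM mulNr mulVf ?pnatr_eq0//.
  by rewrite powR_inv1// mulfV// pnatr_eq0 -lt0n.
apply: le_trans (_ : d ^+ k.+1 <= _).
  have -> : d ^+ k.+1 = n%:R * (d * n%:R `^ (- k.+1%:R^-1)) ^+ k.+1.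
    by rewrite exprMn mulrCA e mulr1.
  apply: (ler_wpM2l (ler0n _ _)); rewrite ler_pXn2r// nnegrE//.
  exact: mulr_ge0 (ltW d0) (powR_ge0 _ _).
apply: le_trans (_ : d <= _); last by rewrite ge_min lexx orbT.
by rewrite exprS ler_piMr ?(ltW d0)// exprn_ile1 ?(ltW d0)// ge_min lexx.
Unshelve. all: by end_near.
Qed.

Hypotheses (k0 : (0 < k)%N) (p01 : forall n, 0 <= p n <= 1).
Hypothesis dense : forall B, \forall n \near \oo, B <= n%:R * p n ^+ k.
Hypothesis sparse : forall eps : R, 0 < eps -> \forall n \near \oo, n%:R * p n ^+ k.+1 <= eps.

Lemma near_pos : \forall n \near \oo, 0 < p n.
Proof.
near=> n; have : 1 <= n%:R * p n ^+ k by near: n.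
have /andP[p0 _] := p01 n; rewrite lt_neqAle p0 andbT; apply: contraTneq => <-.
by rewrite expr0n gtn_eqF//= mulr0 -ltNge.
Unshelve. all: by end_near.
Qed.

Lemma near_le_half : \forall n \near \oo, p n <= 2^-1.
Proof.
near=> n; have n0 : (0 < n)%N by near: n; exact: nbhs_infty_gt.
have h : n%:R * p n ^+ k.+1 <= 2^-1 ^+ k.+1 by near: n; apply: sparse; rewrite exprn_gt0.
have /andP[p0 _] := p01 n.
rewrite -(@ler_pXn2r _ k.+1)// ?nnegrE//; apply: le_trans h.
by rewrite ler_peMl ?exprn_ge0// ler1n.
Unshelve. all: by end_near.
Qed.

(** By [p >= p^k], the variance is at least of the order of [n (n p^k)]. *)
Lemma edge_variance_unbounded (B : R) :
  \forall n \near \oo, B <= 'C(n, 2)%:R * p n * (1 - p n).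
Proof.
near=> n.
have n2 : (2 <= n)%N by near: n; exact: nbhs_infty_ge.
have h : 8 * B <= n%:R * p n ^+ k by near: n.
have ph : p n <= 2^-1 by near: n; exact: near_le_half.
have /andP[p0 p1] := p01 n.
apply: le_trans (_ : 4^-1 * n%:R ^+ 2 * p n * 2^-1 <= _); last first.
  apply: ler_pM; rewrite ?mulr_ge0 ?sqr_ge0//; last by lra.
  rewrite ler_wpM2r// mulrC ler_pdivrMr//.
  have : (n ^ 2 <= 'C(n, 2) * 4)%N by rewrite mulnC; exact: leq_sqr_bin2.
  by rewrite -(ler_nat R) natrM natrX.
apply: le_trans (_ : 8^-1 * (n%:R * p n ^+ k) <= _); first by lra.
have -> : 4^-1 * n%:R ^+ 2 * p n * 2^-1 = 8^-1 * (n%:R * (n%:R * p n)) by field.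
rewrite ler_wpM2l// ler_wpM2l//; apply: le_trans (_ : p n <= _).
  by rewrite -(prednK k0) exprS ler_piMr// exprn_ile1.
by rewrite ler_peMl// ler1n (leq_trans _ n2).
Unshelve. all: by end_near.
Qed.

End asymptotics.

(** * The central limit theorem for the Betti number *)

Section betti_clt.
Context {R : realType} (k : nat) (p : nat -> R).
Hypotheses (k0 : (0 < k)%N) (p01 : forall n, 0 <= p n <= 1).
Hypothesis dense : forall B, \forall n \near \oo, B <= n%:R * p n ^+ k.
Hypothesis sparse : forall eps : R, 0 < eps -> \forall n \near \oo, n%:R * p n ^+ k.+1 <= eps.

Definition standardized_betti n (G : {set edge n}) : R :=
  (betti_rv k n G - mean (p n) (betti_rv k n)) / Num.sqrt (variance (p n) (betti_rv k n)).

(** All three error terms of [variance_betti_sub_edges] tend to [0]. *)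
Lemma near_standardized_betti_edges (theta : R) : 0 < theta -> \forall n \near \oo,
  mean (p n) (fun G : {set edge n} => (standardized_betti G -
    (#|G|%:R - mean (p n) (fun H : {set edge n} => #|H|%:R)) /
    Num.sqrt (variance (p n) (fun H : {set edge n} => #|H|%:R))) ^+ 2) <= theta.
Proof.
move=> th0; have [K bound] := variance_betti_sub_edges R k0.
pose th := Num.min 4^-1 (theta / 2).
have th1 : 0 < th by rewrite lt_min divr_gt0// invr_gt0 ltr0n.
(* Below [d], each of the three error terms is at most a third of the tolerance. *)
pose d := Num.min 1 (th / (3 * (`|K| + 1))).
have K1 : 0 < `|K| + 1 by rewrite ltr_wpDl.
have d0 : 0 < d by rewrite lt_min ltr01/= divr_gt0// mulr_gt0.
have dth : 3 * `|K| * d <= th.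
  apply: le_trans (_ : 3 * (`|K| + 1) * d <= _).
    by rewrite ler_wpM2r ?(ltW d0)// ler_wpM2l// lerDl.
  by rewrite mulrC -ler_pdivlMr ?mulr_gt0// ge_min lexx orbT.
near=> n.
have n2k : (2 * k <= n)%N by near: n; exact: nbhs_infty_ge.
have pn0 : 0 < p n by near: n; exact: (near_pos k0 p01 dense).
have u1 : 1 <= n%:R * p n ^+ k by near: n; exact: dense.
have ud : d^-1 <= n%:R * p n ^+ k by near: n; exact: dense.
have xd : n%:R * p n ^+ k.+1 <= d by near: n; exact: sparse.
have v1 : 1 <= 'C(n, 2)%:R * p n * (1 - p n).
  by near: n; exact: (edge_variance_unbounded k0 p01 dense sparse 1).
have /andP[_ p1] := p01 n.
have vE : 0 < variance (p n) (fun H : {set edge n} => #|H|%:R).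
  by rewrite variance_card card_edge (lt_le_trans ltr01).
have c0 : 0 < edge_coefficient n (p n) k.
  rewrite mulr_gt0 ?exprn_gt0// ltr0n bin_gt0.
  by move: k0 n2k; clear; lia.
have pn01 : 0 < p n <= 1 by rewrite pn0.
have := bound n (p n) n2k pn01 u1.
set u := n%:R * p n ^+ k in u1 ud *; set x := n%:R * p n ^+ k.+1 in xd *.
set V := _ * variance _ _ => hb.
have V0 : 0 <= V by rewrite /V mulr_ge0 ?sqr_ge0// ltW.
have x0 : 0 <= x by rewrite mulr_ge0 ?exprn_ge0// ltW.
have d1 : d <= 1 by rewrite ge_min lexx.
have u0 : 0 < u := lt_le_trans ltr01 u1.
have ui : u^-1 <= d by rewrite -[d]invrK lef_pV2// posrE invr_gt0.
have ui0 : 0 <= u^-1 by rewrite invr_ge0 ltW.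
have xx : x ^+ 2 <= d.
  by rewrite expr2 (le_trans _ xd)// ler_piMl// (le_trans xd).
have hth : K * (u^-1 + x + x ^+ 2) <= th.
  apply: (le_trans _ dth); apply: le_trans (_ : `|K| * (u^-1 + x + x ^+ 2) <= _).
    rewrite ler_wpM2r ?ler_norm//; exact: addr_ge0 (addr_ge0 ui0 x0) (sqr_ge0 x).
  by rewrite -mulrA mulrCA ler_wpM2l//; lra.
apply: le_trans (standardized_close (p01 n) c0 vE (theta := th) _ _) _.
- by rewrite ge_min lexx.
- by apply: (le_trans hb); rewrite ler_wpM2r.
- by rewrite mulrC -ler_pdivlMr// ge_min lexx orbT.
Unshelve. all: by end_near.
Qed.

Lemma near_edges_gauss (F : R -> R) A M : continuous F ->
  (forall a, A < `|a| -> F a = 0) -> (forall a, `|F a| <= M) ->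
  forall eps, 0 < eps -> \forall n \near \oo,
  `|mean (p n) (fun G : {set edge n} => F ((#|G|%:R - mean (p n) (fun H : {set edge n} => #|H|%:R)) /
    Num.sqrt (variance (p n) (fun H : {set edge n} => #|H|%:R)))) - gauss_mean F| <= eps.
Proof.
move=> cF sF bF eps e0; have e20 : 0 < eps / 2 by rewrite divr_gt0.
have [v [L [v0 L0 approx]]] := gaussian_test_approx cF sF bF e20.
have [C C0 clt] := binomial_clt_gkernel v0.
(* A standard deviation of at least [B] brings the binomial error below [eps / 2]. *)
pose B := 1 + 2 * L * C / eps.
have q0 : 0 <= 2 * L * C / eps by rewrite divr_ge0 ?(ltW e0)// mulr_ge0// mulr_ge0.
have B1 : 1 <= B by rewrite lerDl.
near=> n.
have vB : B ^+ 2 <= 'C(n, 2)%:R * p n * (1 - p n).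
  by near: n; exact: (edge_variance_unbounded k0 p01 dense sparse).
rewrite mean_card variance_card card_edge.
set sigma := Num.sqrt _.
have Bs : B <= sigma.
  have B0 : 0 <= B by exact: le_trans B1.
  by rewrite -[B]ger0_norm// -sqrtr_sqr ler_wsqrtr.
have s1 : 1 <= sigma by exact: le_trans B1 Bs.
have s0 : 0 < sigma by exact: lt_le_trans s1.
have sE : sigma ^+ 2 = #|{: edge n}|%:R * p n * (1 - p n).
  by rewrite card_edge sqr_sqrtr// (le_trans _ vB)// sqr_ge0.
have := approx _ (weight (p n)) (fun G : {set edge n} => (#|G|%:R - 'C(n, 2)%:R * p n) / sigma)
  (C / sigma) (weight_ge0 (p01 n)) (sum_weight _ _).
have clt' a := clt _ _ _ (p01 n) s1 sE a; rewrite card_edge in clt'.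
move=> /(_ clt')/le_trans; apply; rewrite [leRHS]splitr lerD2l.
rewrite mulrA ler_pdivrMr//; apply: le_trans (_ : eps / 2 * B <= _); last first.
  by rewrite ler_wpM2l// ltW.
rewrite /B [leRHS]mulrDr mulr1 (_ : eps / 2 * (2 * L * C / eps) = L * C).
  by rewrite lerDr ltW.
by field; exact: lt0r_neq0.
Unshelve. all: by end_near.
Qed.

Lemma near_betti_gauss (F : R -> R) A M : continuous F ->
  (forall a, A < `|a| -> F a = 0) -> (forall a, `|F a| <= M) ->
  forall eps, 0 < eps -> \forall n \near \oo,
  `|mean (p n) (fun G : {set edge n} => F (standardized_betti G)) - gauss_mean F| <= eps.
Proof.
move=> cF sF bF eps e0.
have e20 : 0 < eps / 2 by rewrite divr_gt0.
have e40 : 0 < eps / 4 by rewrite divr_gt0.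
have [K K0 mod] := quadratic_modulus cF sF bF e40.
pose th := eps / 4 / (K + 1); have K1 : 0 < K + 1 by rewrite ltr_wpDl.
have th0 : 0 < th by rewrite divr_gt0.
have Kth : K * th <= eps / 4.
  rewrite /th mulrCA ler_piMr ?(ltW e40)// ler_pdivrMr// mul1r.
  by rewrite lerDl.
apply: filterS2 (near_standardized_betti_edges th0) (near_edges_gauss cF sF bF e20) => n h1 h2.
pose W (G : {set edge n}) : R := (#|G|%:R - mean (p n) (fun H : {set edge n} => #|H|%:R)) /
    Num.sqrt (variance (p n) (fun H : {set edge n} => #|H|%:R)).
rewrite -[X in `|X|](subrKA (mean (p n) (fun G => F (W G)))).
apply: le_trans (ler_normD _ _) _; rewrite [leRHS]splitr; apply: lerD => //.
rewrite -meanB; apply: le_trans (ler_norm_mean (p01 n) _) _.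
apply: le_trans (_ : mean (p n) (fun G => eps / 4 + K * (standardized_betti G - W G) ^+ 2) <= _).
  by apply: le_mean => // G; exact: mod.
rewrite meanD mean_cst meanZ; have := ler_wpM2l K0 h1; lra.
Qed.

End betti_clt.

Theorem theorem2p4 (R : realType) (k : nat) (p : nat -> R)
    (hk : (1 <= k)%N)
    (hp : forall n, 0 <= p n <= 1)
    (hp_omega : little_omega p (fun n => n%:R `^ (- k%:R^-1)))
    (hp_o : p =o_\oo (fun n => n%:R `^ (- k.+1%:R^-1))) :
  weak_cvg
    (fun n => distribution (gnp n (p n))
                (standardized (gnp n (p n)) (betti_rv k n)))
    (normal_prob 0 1).
Proof.
move=> f cf [M0 [_ bf]]; pose M := `|M0| + 1.
have bM a : `|f a| <= M.
  by apply: bf => //; rewrite /M (le_lt_trans (ler_norm M0))// ltrDl.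
have dense := little_omega_degree hk hp_omega.
have p0 n : 0 <= p n by have /andP[] := hp n.
have sparse := little_o_degree hp_o p0.
have lim := bounded_test_functions hp (@near_betti_gauss _ _ _ hk hp dense sparse) cf bM.
rewrite (integral_normal_prob cf bM).
have E n : (\int[distribution (gnp n (p n)) (standardized (gnp n (p n)) (betti_rv k n))]_x (f x)%:E
    = (mean (p n) (fun G : {set edge n} => f (standardized_betti k p G)))%:E)%E.
  rewrite integral_distribution/=.
  - rewrite -integral_gnp//; apply: eq_integral => G _; congr ((f _)%:E).
    by rewrite /standardized expectation_gnp// variance_gnp.
  - by apply/measurable_EFinP; exact: continuous_measurable_fun.
  - apply: measurable_bounded_integrable => //.
      by rewrite (le_lt_trans (probability_le1 _ _))// ltry.
    exists M; split; first exact: num_real.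
    by move=> M' MM' G _; exact: le_trans (bM _) (ltW MM').
under eq_fun do rewrite E.
apply: cvg_EFin; first exact: nearW.
apply/cvgrPdist_le => eps e0; have := lim eps e0; apply: filterS => n.
by rewrite distrC.
Qed.
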